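(* For every integer $d\ge 2$ and every $\epsilon>0$ there is $p_d(\epsilon)$ such that for all integers $p\ge p_d(\epsilon)$ and $q$ with $p^{\frac{d-1}{d}+\epsilon}\le q\le p$ we have $$p-q+1\le \mathrm{HD}_d(p,q)\le p-q+2.$$
   Context: A family $\mathcal F$ of sets satisfies the $(p,q)$-property (for integers $p\ge q\ge 1$) if $|\mathcal F|\ge p$, no member of $\mathcal F$ is empty, and among any $p$ members of $\mathcal F$ there are $q$ with a common point. A set $T$ is a transversal of $\mathcal F$ if $T$ meets every member of $\mathcal F$. For integers $p\ge q\ge d+1$, $\mathrm{HD}_d(p,q)$ denotes the smallest integer $s$ such that every family of compact convex sets in $\mathbb R^d$ satisfying the $(p,q)$-property has a transversal of size at most $s$. *)

(* Defs.v *)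
From Stdlib Require Fin.
From Stdlib Require Import Reals List Arith.
Open Scope R_scope.

Definition Pt (d : nat) : Type := Fin.t d -> R.
Definition PSet (d : nat) : Type := Pt d -> Prop.

Definition convex {d : nat} (S : PSet d) : Prop :=
  forall x y : Pt d, S x -> S y -> forall t : R, 0 <= t <= 1 ->
    S (fun i => t * x i + (1 - t) * y i).

Definition open_set {d : nat} (U : PSet d) : Prop :=
  forall x : Pt d, U x -> exists r : R, 0 < r /\
    forall y : Pt d, (forall i, Rabs (y i - x i) < r) -> U y.

Definition compact {d : nat} (S : PSet d) : Prop :=
  forall (I : Type) (U : I -> PSet d),
    (forall i, open_set (U i)) ->
    (forall x, S x -> exists i, U i x) ->
    exists l : list I, forall x, S x -> exists i, In i l /\ U i x.

Definition family (d : nat) : Type := PSet d -> Prop.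

Definition pq_property {d : nat} (p q : nat) (F : family d) : Prop :=
  (exists l : list (PSet d), length l = p /\ NoDup l /\ Forall F l) /\
  (forall S, F S -> exists x, S x) /\
  (forall l : list (PSet d), length l = p -> NoDup l -> Forall F l ->
     exists l' : list (PSet d), incl l' l /\ NoDup l' /\ length l' = q /\
       exists x : Pt d, Forall (fun S => S x) l').

Definition transversal {d : nat} (T : list (Pt d)) (F : family d) : Prop :=
  forall S, F S -> exists x, In x T /\ S x.

Definition HD_bound (d p q s : nat) : Prop :=
  forall F : family d,
    (forall S, F S -> compact S /\ convex S) ->
    pq_property p q F ->
    exists T : list (Pt d), (length T <= s)%nat /\ transversal T F.

Definition is_HD (d p q s : nat) : Prop :=
  HD_bound d p q s /\ (forall s', HD_bound d p q s' -> (s <= s')%nat).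

(* Main.v *)
(* Let F have the (p,q)-property, with q >= p^((d-1)/d + eps).  If B is a subfamily
   of b members of which at most m intersect, then F \ B has the
   (p - b, q - m)-property.  Fix a large constant Q.  As long as P = p - b is larger
   than (1 + 1/(2d)) q, look at P' ~ P^(1/d) up to a factor p^(o(1)).  If every P'
   members of F \ B contain Q intersecting ones, then F \ B has a transversal of size
   P'^d p^(o(1)) <= P - q, hence F one of size p - q.  Otherwise add to B a subfamily of
   P' members without Q intersecting ones.  In total m grows only by O(Q p^(1-1/d+o(1))),
   which is much less than q, so that at the end the remaining family is in the range
   (d-1)p' < d(q'-1) of the Hadwiger-Debrunner theorem; since B has a transversal of
   size b - m + 1, the total is p - q + 2.

   The transversals of size P'^(d+o(1)) come from the method of Alon and Kleitman:
   fractional Helly for Q-tuples, multiplicative weights instead of LP duality, and weak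
   nets of size r^(d+o(1)).  For the weak nets, points are replaced level by level with
   (k+1)-tuples whose hull meets an axis-parallel flat of codimension k; each flat is
   chosen by a shallow b-ary tree such that a convex set is cut in a balanced way by one
   of the flats, and on the final lines a one-dimensional net suffices. *)
Require Import Defs.
From Stdlib Require Import Reals List Arith.
From Stdlib Require Import ZArith Lra Lia Psatz FinFun ClassicalChoice Wf_nat.
From HB Require structures.
From mathcomp Require all_boot all_order all_algebra boolp Rstruct ring lra zify.
Open Scope R_scope.

(** * The lower bound *)

(** The exponent (d-1)/d reflects the size of the weak nets: the removal lasts about p^(1-1/d)
    rounds because a family in which every s members contain Q intersecting ones has a transversal
    of size s^(d+o(1)). Fractional Helly yields points lying in a fraction of about s^(-Q/(Q-d)) of
    the weight, and a large Q brings this exponent close to -1. All factors p^(o(1)) are powers of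
    one integer b of order p^(1/D); so D is fixed from d and eps alone, and Q, the constant C and
    the threshold for p come after it.

    The difficulty in the nets is that a d-tuple contains smaller tuples lying in many slabs, so
    that the nets built recursively at the nodes of a tree could add up to too much. A node
    therefore forbids all tuples of the current level outside its own set, and larger tuples
    containing a forbidden one no longer count. Each d-tuple is then charged to at most D b nodes.
    The price is that some tuples inside a given convex set are lost, and the balance condition at a
    node makes this loss negligible. *)

Definition diagonal {d : nat} (a b : R) : PSet d :=
  fun x => exists c, a <= c <= b /\ x = (fun _ => c).

Lemma diagonal_convex d a b : Defs.convex (@diagonal d a b).
Proof.
intros x y [c [hc ->]] [c' [hc' ->]] t ht.
exists (t * c + (1 - t) * c'). split; [nra | reflexivity].
Qed.

(** The supremum proof of Heine-Borel: if m is the supremum of the t for which [a, t] has a finite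
    subcover, the set of the cover around m carries a finite subcover past m. *)
Lemma diagonal_compact d a b : Defs.compact (@diagonal d a b).
Proof.
intros I U oU cov. destruct (Rlt_le_dec b a) as [ba|ab].
{ exists nil. intros x [c [hc _]]. lra. }
pose (V := fun i c => U i (fun _ : Fin.t d => c)).
pose (E := fun t => a <= t <= b /\
  exists l : list I, forall c, a <= c <= t -> exists i, In i l /\ V i c).
assert (Va : forall c, a <= c <= b -> exists i, V i c /\
  exists r, 0 < r /\ forall y, Rabs (y - c) < r -> V i y).
{ intros c hc. destruct (cov (fun _ => c)) as [i hi]; [now exists c|].
  exists i. split; [exact hi|]. destruct (oU i _ hi) as [r [r0 hr]].
  exists r. split; [exact r0|]. intros y hy. apply hr. intros _. exact hy. }
assert (Ea : E a).
{ split; [lra|]. destruct (Va a) as [i [hi _]]; [lra|].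
  exists (i :: nil). intros c hc. exists i. replace c with a by lra. split; [now left | exact hi]. }
destruct (completeness E) as [m [hub hlub]].
{ exists b. intros t [ht _]. lra. }
{ now exists a. }
assert (am : a <= m) by (apply hub, Ea).
assert (mb : m <= b) by (apply hlub; intros t [ht _]; lra).
destruct (Va m) as [i [_ [r [r0 hr]]]]; [lra|].
assert (ext : forall t, a <= t <= b -> t < m + r -> E t).
{ intros t ht tr. split; [exact ht|].
  destruct (Classical_Prop.classic (exists u, E u /\ m - r < u)) as [[u [[hu [l hl]] mu]]|no].
  - exists (i :: l). intros c hc. destruct (Rle_lt_dec c u) as [cu|uc].
    + destruct (hl c) as [j [jl Vj]]; [lra|]. exists j. split; [now right | exact Vj].
    + exists i. split; [now left|]. apply hr. apply Rabs_def1; lra.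
  - assert (m <= m - r); [|lra]. apply hlub. intros u Eu.
    destruct (Rle_lt_dec u (m - r)) as [h|h]; [exact h|]. exfalso. apply no. now exists u. }
assert (Eb : E b).
{ apply ext; [lra|]. destruct (Rle_lt_dec b m) as [h|h]; [lra|].
  assert (hm : E (Rmin b (m + r / 2))).
  { apply ext; [split; [apply Rmin_glb; lra | apply Rmin_l] |].
    assert (Rmin b (m + r / 2) <= m + r / 2) by apply Rmin_r. lra. }
  apply hub in hm. unfold Rmin in hm. destruct (Rle_dec b (m + r / 2)); lra. }
destruct Eb as [_ [l hl]]. exists l. intros x [c [hc ->]]. exact (hl c hc).
Qed.

Section LowerBound.
Variables (d p q : nat).
Hypotheses (d0 : (0 < d)%nat) (q0 : (0 < q)%nat) (qp : (q <= p)%nat).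

Let const (c : R) : Pt d := fun _ => c.

Lemma const_inj c c' : const c = const c' -> c = c'.
Proof. intro h. destruct d as [|n]; [lia|]. exact (f_equal (fun x => x Fin.F1) h). Qed.

Lemma diagonal_const a b c : @diagonal d a b (const c) <-> a <= c <= b.
Proof.
split; [|now exists c]. intros [c' [h e]]. now apply const_inj in e as ->.
Qed.

Let star : list (PSet d) := map (fun k => diagonal (- INR k) 0) (seq 0 q).
Let isolated : list (PSet d) := map (fun k => diagonal (INR k) (INR k)) (seq 1 (p - q)).

Lemma star_isolated_NoDup : NoDup (star ++ isolated).
Proof.
apply NoDup_app.
- apply FinFun.Injective_map_NoDup; [|apply seq_NoDup]. intros k k' e.
  assert (h : forall c, - INR k <= c <= 0 <-> - INR k' <= c <= 0).
  { intro c. rewrite <- !diagonal_const, e. reflexivity. }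
  assert (h1 := pos_INR k). assert (h2 := pos_INR k').
  destruct (proj1 (h (- INR k))) as [h3 _]; [lra|].
  destruct (proj2 (h (- INR k'))) as [h4 _]; [lra|].
  apply INR_eq. lra.
- apply FinFun.Injective_map_NoDup; [|apply seq_NoDup]. intros k k' e.
  assert (h : INR k <= INR k <= INR k -> INR k' <= INR k <= INR k').
  { rewrite <- !diagonal_const, e. trivial. }
  apply INR_eq. lra.
- intros S [k [<- _]] % in_map_iff [k' [e hk]] % in_map_iff. apply in_seq in hk.
  assert (h : INR k' <= INR k' <= INR k' -> - INR k <= INR k' <= 0).
  { rewrite <- !diagonal_const, e. trivial. }
  assert (1 <= INR k') by (apply (le_INR 1); lia). lra.
Qed.

(** The extremal family consists of q nested segments ending at the origin and p - q further points
    of the diagonal. It has exactly p members, so the property has to be checked for the whole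
    family only, where the star intersects. The one-point members at 0, 1, ..., p - q force as many
    distinct points into T. *)
Lemma HD_lower_bound s : HD_bound d p q s -> (p - q + 1 <= s)%nat.
Proof.
intro hs. pose (F := fun S => In S (star ++ isolated)).
assert (len : length (star ++ isolated) = p).
{ rewrite length_app. unfold star, isolated. rewrite !length_map, !length_seq. lia. }
assert (all : Forall F (star ++ isolated)) by (apply Forall_forall; trivial).
destruct (hs F) as [T [Ts hT]].
- intros S hS. apply in_app_iff in hS. unfold star, isolated in hS. rewrite !in_map_iff in hS.
  destruct hS as [[k [<- _]]|[k [<- _]]]; split; apply diagonal_compact || apply diagonal_convex.
- split; [|split].
  + exists (star ++ isolated). split; [exact len|]. split; [exact star_isolated_NoDup | exact all].
  + intros S hS. apply in_app_iff in hS. unfold star, isolated in hS. rewrite !in_map_iff in hS.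
    destruct hS as [[k [<- _]]|[k [<- _]]].
    * exists (const 0). apply diagonal_const. assert (h := pos_INR k). lra.
    * exists (const (INR k)). apply diagonal_const. lra.
  + intros l ll nl Fl. exists star.
    assert (incl (star ++ isolated) l).
    { apply NoDup_length_incl; [exact nl | lia |].
      intros S hS. exact (proj1 (Forall_forall F l) Fl S hS). }
    split; [intros S hS; apply H, in_app_iff; now left|].
    split; [exact (NoDup_app_remove_r _ _ star_isolated_NoDup)|].
    split; [unfold star; now rewrite length_map, length_seq|].
    exists (const 0). apply Forall_forall. intros S hS. unfold star in hS.
    apply in_map_iff in hS as [k [<- _]]. apply diagonal_const. assert (h := pos_INR k). lra.
- assert (inc : incl (map (fun k => const (INR k)) (seq 0 (p - q + 1))) T).
  { intros x hx. apply in_map_iff in hx as [k [<- hk]]. apply in_seq in hk.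
    destruct (hT (diagonal (INR k) (INR k))) as [x [xT [c [hc ->]]]].
    - apply in_app_iff. destruct k as [|k].
      (* The point 0 is forced by the degenerate segment of the star. *)
      + left. unfold star. apply in_map_iff. exists 0%nat. split; [|apply in_seq; lia].
        simpl. f_equal. lra.
      + right. unfold isolated. apply in_map_iff. exists (S k). split; [reflexivity | apply in_seq; lia].
    - replace (INR k) with c by lra. exact xT. }
  apply NoDup_incl_length in inc.
  + rewrite length_map, length_seq in inc. lia.
  + apply FinFun.Injective_map_NoDup; [|apply seq_NoDup]. intros k k' e.
    apply const_inj in e. now apply INR_eq.
Qed.

End LowerBound.

(** * The choice of the parameters *)

Lemma Rpower_pow_nat x y n : 0 < x -> Rpower x y ^ n = Rpower x (y * INR n).
Proof.
intro x0. rewrite <- Rpower_pow by (unfold Rpower; apply exp_pos).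
now rewrite Rpower_mult.
Qed.

Lemma Rpower_ge_1 x y : 1 <= x -> 0 <= y -> 1 <= Rpower x y.
Proof.
intros x1 y0. rewrite <- (Rpower_O x) by lra. now apply Rle_Rpower.
Qed.

Lemma nat_ceil x : 0 <= x -> exists n, x <= INR n <= x + 1.
Proof.
intro x0. destruct (archimed x) as [h1 h2].
assert (u0 : (0 <= up x)%Z) by (apply le_IZR; lra).
exists (Z.to_nat (up x)). rewrite INR_IZR_INZ, Z2Nat.id by exact u0. lra.
Qed.

Lemma nat_floor x : 0 <= x -> exists n, INR n <= x < INR n + 1.
Proof.
intro x0. destruct (archimed x) as [h1 h2].
assert (u0 : (0 < up x)%Z) by (apply lt_IZR; lra).
exists (Z.to_nat (up x - 1)). rewrite INR_IZR_INZ, Z2Nat.id by lia.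
rewrite minus_IZR. lra.
Qed.

Lemma Rpower_unbounded c s : 0 < s -> exists p0 : nat, forall p, (p0 <= p)%nat ->
  c <= Rpower (INR p) s.
Proof.
intro s0. pose (c' := Rmax c 1).
assert (c1 : 1 <= c') by apply Rmax_r.
destruct (nat_ceil (Rpower c' (/ s))) as [p0 hp].
{ apply Rlt_le, exp_pos. }
exists p0. intros p pp. apply Rle_trans with c'; [apply Rmax_l|].
replace c' with (Rpower (Rpower c' (/ s)) s) at 1.
- apply Rle_Rpower_l; [lra|]. split; [apply exp_pos|].
  apply Rle_trans with (INR p0); [lra | now apply le_INR].
- rewrite Rpower_mult, Rinv_l, Rpower_1; lra.
Qed.

(* (1 - x)^a <= exp (- a x) <= 1 - a x / 2. *)
Lemma Rpower_decrement t s a : 0 < s < t -> 0 < a <= 1 ->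
  Rpower (t - s) a <= Rpower t a * (1 - a * (s / t) / 2).
Proof.
intros st a01. set (x := s / t).
assert (tx : s = t * x) by (unfold x; field; lra).
assert (x01 : 0 < x < 1) by (split; [apply Rdiv_lt_0_compat|]; nra).
replace (t - s) with (t * (1 - x)) by (rewrite tx; ring).
rewrite <- Rpower_mult_distr by lra.
apply Rmult_le_compat_l; [apply Rlt_le, exp_pos|].
unfold Rpower. set (u := a * x).
assert (u01 : 0 < u <= 1) by (unfold u; nra).
assert (l : ln (1 - x) <= - x).
{ rewrite <- (ln_exp (- x)). destruct (Req_dec (1 - x) (exp (- x))) as [->|ne]; [lra|].
  apply Rlt_le, ln_increasing; [lra|]. assert (h := exp_ineq1_le (- x)). lra. }
apply Rle_trans with (exp (- u)).
- destruct (Req_dec (a * ln (1 - x)) (- u)) as [->|ne]; [lra|].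
  apply Rlt_le, exp_increasing. unfold u in *. nra.
- rewrite exp_Ropp. assert (h := exp_ineq1_le u).
  apply Rmult_le_reg_l with (exp u); [lra|]. rewrite Rinv_r by lra. nra.
Qed.

Lemma INR_pow n k : INR (n ^ k)%nat = INR n ^ k.
Proof. now rewrite pow_INR. Qed.

Section GreedyParameters.
Variables (d : nat) (eps : R).
Hypotheses (d2 : (2 <= d)%nat) (eps0 : 0 < eps).
(** The power of b lost in [polynomial_transversal]. *)
Let w : nat := (2 * d * d + d)%nat.
Let a := INR (d - 1) / INR d.

Lemma exponent_bounds : / 2 <= a < 1 /\ a = 1 - / INR d.
Proof.
assert (d2' : 2 <= INR d) by (apply (le_INR 2); exact d2).
assert (e : a = 1 - / INR d).
{ unfold a. rewrite minus_INR by lia. simpl INR. field. lra. }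
assert (/ INR d <= / 2) by (apply Rinv_le_contravar; lra).
assert (0 < / INR d) by (apply Rinv_0_lt_compat; lra).
split; [lra | exact e].
Qed.

(** With s the floor of P^(1/d) / Lam, the potential 8 Lam P^a drops by at least 4 a Lam s /
    P^(1/d). The floor loses at most a factor 2 and a >= 1/2, so the drop is at least 1; this is the
    origin of the 8. The potential bounds the number of rounds still to come. *)
Lemma greedy_step (P Lam : nat) : (1 <= Lam)%nat -> (Lam ^ d <= P)%nat -> exists s : nat,
  (0 < s)%nat /\ (Lam * s ^ d <= P)%nat /\ (s <= P)%nat /\
  ((s < P)%nat -> 8 * INR Lam * Rpower (INR (P - s)) a + 1 <= 8 * INR Lam * Rpower (INR P) a).
Proof.
intros L1 LP. destruct exponent_bounds as [[a2 a1] ae].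
assert (d2' : 2 <= INR d) by (apply (le_INR 2); exact d2).
assert (L1' : 1 <= INR Lam) by (apply (le_INR 1); exact L1).
assert (Ld : 1 <= INR Lam ^ d) by (apply pow_R1_Rle; exact L1').
assert (LP' : INR Lam ^ d <= INR P) by (rewrite <- INR_pow; apply le_INR, LP).
set (z := Rpower (INR P) (/ INR d)).
assert (zd : z ^ d = INR P).
{ unfold z. rewrite Rpower_pow_nat, Rinv_l, Rpower_1; lra. }
assert (z0 : 0 < z) by apply exp_pos.
assert (zL : INR Lam <= z).
{ destruct (Rle_lt_dec (INR Lam) z) as [h|h]; [exact h|exfalso].
  assert (z ^ d < INR Lam ^ d); [|lra].
  destruct d as [|k]; [lia|]. clear - z0 h.
  simpl. apply Rle_lt_trans with (z * INR Lam ^ k).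
  - apply Rmult_le_compat_l; [lra|]. apply pow_incr; lra.
  - apply Rmult_lt_compat_r; [apply pow_lt; lra | exact h]. }
assert (zL1 : 1 <= z / INR Lam).
{ apply Rmult_le_reg_r with (INR Lam); [lra|]. unfold Rdiv. rewrite Rmult_assoc, Rinv_l; lra. }
destruct (nat_floor (z / INR Lam)) as [s [s1 s2]]; [lra|].
assert (s0 : (0 < s)%nat) by (apply INR_lt; simpl; lra).
assert (s1' : 1 <= INR s) by (apply (le_INR 1); lia).
assert (Ls : INR Lam * INR s <= z).
{ replace z with (INR Lam * (z / INR Lam)) by (field; lra). apply Rmult_le_compat_l; lra. }
assert (Lsd : INR Lam * INR s ^ d <= INR P).
{ rewrite <- zd. apply Rle_trans with ((INR Lam * INR s) ^ d).
  - rewrite Rpow_mult_distr. apply Rmult_le_compat_r; [apply pow_le; lra|].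
    rewrite <- (pow_1 (INR Lam)) at 1. apply Rle_pow; [exact L1' | lia].
  - apply pow_incr. nra. }
exists s. split; [exact s0|]. split; [|split].
- apply INR_le. rewrite mult_INR, INR_pow. exact Lsd.
- apply INR_le. apply Rle_trans with (2 := Lsd).
  assert (INR s <= INR s ^ d) by (rewrite <- (pow_1 (INR s)) at 1; apply Rle_pow; [lra | lia]).
  nra.
- intro sP. assert (sP' : INR s < INR P) by (apply lt_INR, sP).
  rewrite minus_INR by lia.
  assert (dec := Rpower_decrement (INR P) (INR s) a ltac:(lra) ltac:(lra)).
  assert (Pa : Rpower (INR P) a * z = INR P).
  { unfold z. rewrite <- Rpower_plus. replace (a + / INR d) with 1 by lra. apply Rpower_1; lra. }
  set (t := Rpower (INR P) a) in *. assert (t0 : 0 < t) by apply exp_pos.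
  assert (key : 1 <= 8 * INR Lam * (t * (a * (INR s / INR P) / 2))); [|nra].
  replace (INR s / INR P) with (INR s / (t * z)) by (rewrite Pa; reflexivity).
  replace (8 * INR Lam * (t * (a * (INR s / (t * z)) / 2))) with (4 * a * (INR Lam * INR s) / z) by (field; lra).
  apply Rmult_le_reg_r with z; [exact z0|].
  unfold Rdiv. rewrite Rmult_assoc, Rinv_l, Rmult_1_r, Rmult_1_l by lra.
  assert (z <= 2 * (INR Lam * INR s)).
  { apply Rle_trans with (INR Lam * (2 * INR s)); [|lra].
    replace z with (INR Lam * (z / INR Lam)) by (field; lra). apply Rmult_le_compat_l; lra. }
  nra.
Qed.

(** All the arithmetic of the removal process: [st P] is the size of the subfamily tested when P
    members are left, [phi] the potential, [P0] the point where the process stops. The order of the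
    quantifiers matters, since Q and C are produced by [polynomial_transversal] from D. *)
Lemma parameters : exists D : nat, (0 < D)%nat /\ forall Q C : nat, exists p0 : nat,
  forall p q : nat, (p0 <= p)%nat -> Rpower (INR p) (a + eps) <= INR q -> (q <= p)%nat ->
  (0 < p)%nat /\
  exists (b P0 : nat) (st : nat -> nat) (phi : nat -> R),
  (0 < b)%nat /\ (p <= b ^ D)%nat /\ (forall P, 0 <= phi P) /\
  (forall P, (P0 < P)%nat -> (P <= p)%nat ->
     (0 < st P < P)%nat /\ phi (P - st P)%nat + 1 <= phi P /\
     (C * b ^ w * st P ^ d + q <= P)%nat) /\
  (forall P m, (0 < P)%nat -> (P <= P0)%nat -> INR m <= INR Q * phi p ->
     (d * (P + m + 1) + 1 <= P + d * q)%nat).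
Proof.
destruct exponent_bounds as [[a2 a1] ae].
assert (d2' : 2 <= INR d) by (apply (le_INR 2); exact d2).
(* The first term gives w / D <= eps / 2, the second w d / D <= 1/4. *)
destruct (nat_ceil (2 * INR w / eps + 4 * INR w * INR d + 1)) as [D [hD _]].
{ assert (0 <= INR w) by apply pos_INR. assert (0 <= 2 * INR w / eps).
  { apply Rmult_le_pos; [lra | apply Rlt_le, Rinv_0_lt_compat, eps0]. } nra. }
assert (w0 : 0 <= INR w) by apply pos_INR.
assert (we0 : 0 <= 2 * INR w / eps).
{ apply Rmult_le_pos; [lra | apply Rlt_le, Rinv_0_lt_compat, eps0]. }
assert (D1 : 1 <= INR D) by nra.
exists D. split. { apply INR_lt. simpl. lra. }
intros Q C.
(* Lambda = K1 * b^w, and b <= 2 p^(1/D), so Lambda <= K2 p^(w/D) *)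
pose (K1 := (3 * d * (C + 1))%nat). pose (K2 := INR K1 * 2 ^ w).
assert (K11 : 1 <= INR K1) by (apply (le_INR 1); unfold K1; nia).
assert (K21 : 1 <= K2).
{ unfold K2. assert (1 <= 2 ^ w) by (apply pow_R1_Rle; lra). nra. }
(* The threshold [p1] makes d (m + 2) <= q / 4 at the end of the process; [p2] gives Lam^d <=
   p^(1/2) <= q, so that [greedy_step] applies beyond [P0]. *)
destruct (Rpower_unbounded (4 * INR d * (INR Q * (8 * K2) + 2)) (eps / 2)) as [p1 hp1]; [lra|].
destruct (Rpower_unbounded (K2 ^ d) (/ 4)) as [p2 hp2]; [lra|].
exists (p1 + p2 + 1)%nat. intros p q pp hq qp.
assert (p1' : 1 <= INR p) by (apply (le_INR 1); lia).
specialize (hp1 p ltac:(lia)). specialize (hp2 p ltac:(lia)).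
split; [lia|].
destruct (nat_ceil (Rpower (INR p) (/ INR D))) as [b [hb1 hb2]]; [apply Rlt_le, exp_pos|].
assert (pD1 : 1 <= Rpower (INR p) (/ INR D)).
{ apply Rpower_ge_1; [exact p1' | apply Rlt_le, Rinv_0_lt_compat; lra]. }
assert (b0 : (0 < b)%nat) by (apply INR_lt; simpl; lra).
pose (Lam := (K1 * b ^ w)%nat).
assert (bw1 : (1 <= b ^ w)%nat) by (assert (h := Nat.pow_nonzero b w); lia).
assert (L1 : (1 <= Lam)%nat) by (unfold Lam; apply INR_le in K11 || (assert (1 <= K1)%nat by (apply INR_le; exact K11)); nia).
assert (LK : INR Lam <= K2 * Rpower (INR p) (INR w / INR D)).
{ unfold Lam, K2. rewrite mult_INR, INR_pow, Rmult_assoc. apply Rmult_le_compat_l; [lra|].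
  replace (Rpower (INR p) (INR w / INR D)) with (Rpower (INR p) (/ INR D) ^ w).
  - rewrite <- Rpow_mult_distr. apply pow_incr. lra.
  - rewrite Rpower_pow_nat by lra. f_equal. field. lra. }
assert (wD1 : INR w / INR D <= eps / 2).
{ apply Rmult_le_reg_r with (INR D); [lra|]. unfold Rdiv at 1. rewrite Rmult_assoc, Rinv_l by lra.
  assert (eps * (2 * INR w / eps) = 2 * INR w) by (field; lra). nra. }
assert (wD2 : INR w / INR D * INR d <= / 4).
{ apply Rmult_le_reg_r with (INR D); [lra|].
  replace (INR w / INR D * INR d * INR D) with (INR w * INR d) by (field; lra). nra. }
assert (LK1 : INR Lam <= K2 * Rpower (INR p) (eps / 2)).
{ apply Rle_trans with (1 := LK). apply Rmult_le_compat_l; [lra|]. apply Rle_Rpower; lra. }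
assert (qLd : INR Lam ^ d <= INR q).
{ apply Rle_trans with ((K2 * Rpower (INR p) (INR w / INR D)) ^ d).
  { apply pow_incr. split; [apply pos_INR | exact LK]. }
  rewrite Rpow_mult_distr, Rpower_pow_nat by lra.
  apply Rle_trans with (Rpower (INR p) (/ 4) * Rpower (INR p) (/ 4)).
  { apply Rmult_le_compat; [apply pow_le; lra | apply Rlt_le, exp_pos | exact hp2 |].
    apply Rle_Rpower; lra. }
  rewrite <- Rpower_plus. apply Rle_trans with (2 := hq). apply Rle_Rpower; lra. }
pose (phi := fun P : nat => 8 * INR Lam * Rpower (INR P) a).
pose (P0 := (q + q / (2 * d))%nat).
assert (Lqd : (Lam ^ d <= q)%nat) by (apply INR_le; rewrite INR_pow; exact qLd).
assert (steps : forall P, exists s, (P0 < P)%nat -> (P <= p)%nat ->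
  (0 < s < P)%nat /\ phi (P - s)%nat + 1 <= phi P /\ (C * b ^ w * s ^ d + q <= P)%nat).
{ intro P. destruct (le_lt_dec P P0) as [h|h]; [exists 0%nat; lia|].
  destruct (greedy_step P Lam L1) as [s [s0 [Ls [sP step]]]]; [unfold P0 in h; lia|].
  exists s. intros _ Pp.
  assert (sd : (s <= s ^ d)%nat).
  { rewrite <- (Nat.pow_1_r s) at 1. apply Nat.pow_le_mono_r; lia. }
  assert (sP' : (s < P)%nat).
  { assert (3 <= Lam)%nat by (unfold Lam, K1; nia). nia. }
  split; [lia|]. split; [exact (step sP')|].
  assert (qd := Nat.div_mod q (2 * d) ltac:(lia)).
  assert (qm := Nat.mod_upper_bound q (2 * d) ltac:(lia)).
  set (r := (q / (2 * d))%nat) in *. assert (Pr : (q + r < P)%nat) by exact h.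
  (* Beyond [P0] the gap P - q is a fixed fraction of P; the factor 3 d in [K1] turns a bound by P
     into a bound by P - q. *)
  assert (P <= 3 * d * (P - q))%nat by nia.
  assert (3 * d * (C * b ^ w * s ^ d) <= P)%nat by (unfold Lam, K1 in Ls; nia).
  nia. }

apply choice in steps. destruct steps as [st hst].
exists b, P0, st, phi.
split; [exact b0|]. split.
{ apply INR_le. rewrite INR_pow. apply Rle_trans with (Rpower (INR p) (/ INR D) ^ D).
  - rewrite Rpower_pow_nat, Rinv_l, Rpower_1; lra.
  - apply pow_incr; lra. }
split. { intro P. unfold phi. assert (0 <= INR Lam) by apply pos_INR.
  assert (0 < Rpower (INR P) a) by apply exp_pos. nra. }
split; [exact hst|].
intros P m P1 PP0 hm.
assert (big : INR d * (INR m + 2) <= INR q / 4).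
(* One factor p^(eps/2) of q pays for [Lam], the other for the constants. *)
{ assert (pe : Rpower (INR p) (eps / 2) * Rpower (INR p) (eps / 2) * Rpower (INR p) a <= INR q).
  { rewrite <- !Rpower_plus. apply Rle_trans with (2 := hq). apply Req_le. f_equal. lra. }
  set (u := Rpower (INR p) (eps / 2)) in *. unfold phi in hm.
  set (v := Rpower (INR p) a) in *.
  assert (u1 : 1 <= u) by (apply Rpower_ge_1; lra).
  assert (v1 : 1 <= v) by (apply Rpower_ge_1; lra).
  assert (Q0 : 0 <= INR Q) by apply pos_INR.
  assert (hm' : INR m + 2 <= (INR Q * (8 * K2) + 2) * (u * v)).
  { assert (INR Q * (8 * INR Lam * v) <= INR Q * (8 * (K2 * u) * v)).
    { apply Rmult_le_compat_l; [exact Q0|]. apply Rmult_le_compat_r; lra. }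
    assert (1 <= u * v) by nra. nra. }
  assert (0 < u * v) by nra.
  assert (4 * INR d * (INR Q * (8 * K2) + 2) * (u * v) <= u * (u * v)) by (apply Rmult_le_compat_r; lra).
  assert (INR d * (INR m + 2) <= INR d * ((INR Q * (8 * K2) + 2) * (u * v))) by (apply Rmult_le_compat_l; lra).
  nra. }
assert (big' : (4 * (d * (m + 2)) <= q)%nat).
{ apply INR_le. rewrite !mult_INR, plus_INR. simpl (INR 2). simpl (INR 4). lra. }
assert (qd := Nat.div_mod q (2 * d) ltac:(lia)).
set (r := (q / (2 * d))%nat) in *. unfold P0 in PP0.
assert (2 * d * r <= q)%nat by lia.
assert ((d - 1) * P <= (d - 1) * (q + r))%nat by nia.
nia.
Qed.

End GreedyParameters.

Module UpperBound.
Import HB.structures all_boot all_order all_algebra boolp Rstruct.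
Import mathcomp.algebra_tactics.ring mathcomp.algebra_tactics.lra mathcomp.zify.zify.
Import Order.TTheory GRing.Theory Num.Theory.
Local Open Scope ring_scope.
Set Implicit Arguments.
Unset Strict Implicit.
Unset Printing Implicit Defensive.

(** * Carathéodory and Helly *)

Section Weights.
Variables (I : finType).
Implicit Types (s t : {set I}) (w : I -> R) (X : I -> nat -> R).

(** Coefficients live on the whole index type and vanish outside s, and a point is a sequence of
    which the first k coordinates are used, so that the subset and the number of coordinates can
    vary without changing types. *)
Definition weights s w :=
  [/\ forall i, 0 <= w i, forall i, i \notin s -> w i = 0 & \sum_i w i = 1].

(** A nonzero vector in the left kernel of the matrix with rows (1, X i 0, ..., X i (k-1)). Its
    entries sum to 0, hence one of them is positive. *)
Lemma affine_dependency s k X : (k.+1 < #|s|)%N ->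
  exists l : I -> R, [/\ forall i, i \notin s -> l i = 0, \sum_i l i = 0,
    forall j, (j < k)%N -> \sum_i l i * X i j = 0 & exists i, 0 < l i].
Proof.
move=> ks.
pose M : 'M[R]_(#|s|, k.+1) :=
  \matrix_(a, j) (if j == ord0 then 1 else X (enum_val a) j.-1).
have : kermx M != 0.
  rewrite kermx_eq0 /row_free; apply/eqP => rM.
  by move: (rank_leq_col M); rewrite rM leqNgt ks.
case/rowV0Pn=> v /sub_kermxP vM v0.
have [i0 i0s] : exists i, i \in s by apply/card_gt0P; apply: leq_ltn_trans ks.
pose l i := if i \in s then v ord0 (enum_rank_in i0s i) else 0.
have sumE (F : I -> R) : \sum_i l i * F i = \sum_a v ord0 a * F (enum_val a).
  rewrite (bigID (mem s)) /= [X in _ + X]big1 => [|i /negPf iNs]; last first.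
    by rewrite /l iNs mul0r.
  rewrite addr0 big_enum_val /=; apply: eq_bigr => a _.
  by rewrite /l enum_valP enum_valK_in.
have vM0 j : \sum_a v ord0 a * M a j = 0.
  by move/rowP: vM => /(_ j); rewrite !mxE.
have l0 i : i \notin s -> l i = 0 by rewrite /l => /negPf->.
have suml : \sum_i l i = 0.
  under eq_bigr do rewrite -[l _]mulr1.
  rewrite (sumE (fun=> 1)) -[RHS](vM0 ord0); apply: eq_bigr => a _.
  by rewrite mxE eqxx.
exists l; split=> // [j jk|].
  rewrite sumE -[RHS](vM0 (lift ord0 (Ordinal jk))); apply: eq_bigr => a _.
  by rewrite mxE.
apply: contrapT => /forallNP lpos.
have lle0 i : l i <= 0 by rewrite leNgt; apply/negP/lpos.
have l00 i : l i = 0.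
  apply/eqP; rewrite -oppr_eq0; apply/eqP.
  apply: (@psumr_eq0P _ _ predT (fun i => - l i)) => // [{}i _|].
    by rewrite oppr_ge0.
  by rewrite sumrN suml oppr0.
case/negP: v0; apply/eqP/rowP => a; rewrite mxE.
by rewrite -(l00 (enum_val a)) /l enum_valP enum_valK_in.
Qed.

(* The hull of the points [X i], i in [s], meets the flat {x_0 = c 0, ..., x_(k-1) = c (k-1)}. *)
Definition crosses k (c : nat -> R) X s :=
  exists2 w, weights s w & forall j, (j < k)%N -> \sum_i w i * X i j = c j.

Lemma weights_subset s t w : s \subset t -> weights s w -> weights t w.
Proof.
move=> st [w0 ws w1]; split=> // i it; apply: ws; apply: contra it.
exact: subsetP.
Qed.

Lemma crosses_subset k c X s t : s \subset t -> crosses k c X s -> crosses k c X t.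
Proof. by move=> st [w ws wc]; exists w => //; exact: weights_subset ws. Qed.

Lemma crosses_caratheodory_step k c X s : (k.+1 < #|s|)%N -> crosses k c X s ->
  exists2 i, i \in s & crosses k c X (s :\ i).
Proof.
move=> ks [w [w0 ws w1] wc].
have [l [ls l0 lX [i0 li0]]] := affine_dependency X ks.
(* The weights move along the dependency until the first of them vanishes, at the i that minimises w
   i / l i. *)
case: (@arg_minP _ _ _ i0 (fun i => 0 < l i) (fun i => w i / l i) li0) => i li imin.
have is_ : i \in s by apply/negPn/negP => /ls E; rewrite E ltxx in li.
exists i => //; exists (fun j => w j - w i / l i * l j).
  split=> [j|j|].
  - rewrite subr_ge0; have [lj|lj] := ltP 0 (l j).
      by rewrite -ler_pdivlMr //; apply: imin.
    apply: le_trans (w0 j); rewrite mulr_ge0_le0 // divr_ge0 //; exact: ltW.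
  - rewrite !inE negb_and negbK => /orP[/eqP->|jNs].
      by rewrite divfK ?subrr // gt_eqF.
    by rewrite (ws j) // (ls j) // mulr0 subrr.
  by rewrite big_split /= sumrN -mulr_sumr l0 mulr0 subr0.
move=> j jk; under eq_bigr do rewrite mulrBl -[w i / _ * _ * _]mulrA.
by rewrite sumrB -mulr_sumr lX // mulr0 subr0 wc.
Qed.

(** Only the k coordinates fixed by the flat are constrained, so k + 1 points suffice whatever the
    dimension of the space. *)
Lemma crosses_caratheodory k c X s : crosses k c X s ->
  exists2 t : {set I}, t \subset s & (#|t| <= k.+1)%N /\ crosses k c X t.
Proof.
have [n] := ubnP #|s|; elim: n s => // n IH s sn cs.
have [sk|ks] := leqP #|s| k.+1; first by exists s.
have [i is_ ci] := crosses_caratheodory_step ks cs.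
have [|t ts [tk ct]] := IH (s :\ i) _ ci.
  by move: sn; rewrite (cardsD1 i s) is_ ltnS.
by exists t => //; apply: subset_trans ts (subsetDl _ _).
Qed.

Lemma subset_extend s t m : s \subset t -> (#|s| <= m <= #|t|)%N ->
  exists u : {set I}, [/\ s \subset u, u \subset t & #|u| = m].
Proof.
move=> st /andP[sm mt]; have [n] := ubnP (m - #|s|)%N.
elim: n s st sm => // n IH s st sm mn.
have [->|ms] := eqVneq m #|s|; first by exists s.
have {}ms : (#|s| < m)%N by rewrite ltn_neqAle eq_sym ms.
have [i iB] : exists i, i \in t :\: s.
  by apply/card_gt0P; rewrite cardsD (setIidPr st) subn_gt0; exact: leq_trans mt.
move: iB; rewrite inE => /andP[iNs it].
have [|||u [su ut um]] := IH (i |: s).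
- by rewrite subUset sub1set it.
- by rewrite cardsU1 iNs.
- by rewrite cardsU1 iNs; lia.
by exists u; split=> //; apply: subset_trans su; exact: subsetUr.
Qed.

Lemma crosses_caratheodory_eq k c X s : (k.+1 <= #|s|)%N -> crosses k c X s ->
  exists t : {set I}, [/\ t \subset s, #|t| = k.+1 & crosses k c X t].
Proof.
move=> ks /crosses_caratheodory [t ts [tk ct]].
have [|u [tu us uk]] := @subset_extend t s k.+1 ts; first by rewrite tk.
by exists u; split=> //; exact: crosses_subset ct.
Qed.

Lemma weights_mix s t w v a : 0 <= a <= 1 -> weights s w -> weights t v ->
  weights (s :|: t) (fun i => a * w i + (1 - a) * v i).
Proof.
move=> /andP[a0 a1] [w0 ws w1] [v0 vt v1]; split=> [i|i|].
- by rewrite addr_ge0 // mulr_ge0 // subr_ge0.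
- by rewrite inE negb_or => /andP[/ws-> /vt->]; rewrite !mulr0 addr0.
by rewrite big_split /= -!mulr_sumr w1 v1; ring.
Qed.

Lemma convex_weights d (C : PSet d) (x : I -> Pt d) s w : Defs.convex C ->
  weights s w -> (forall i, i \in s -> C (x i)) ->
  C (fun a => \sum_i w i * x i a).
Proof.
move=> Cc; have [n] := ubnP #|s|; elim: n s w => // n IH s w sn [w0 ws w1] xC.
have [i wi] : exists i, 0 < w i.
  apply: contrapT => /forallNP wN; have : \sum_i w i <= 0.
    by apply: sumr_le0 => i _; rewrite leNgt; apply/negP/wN.
  by rewrite w1 ler10.
have is_ : i \in s by apply/negPn/negP => /ws E; rewrite E ltxx in wi.
have wi1 : w i <= 1.
  by rewrite -w1 (bigD1 i) //= lerDl sumr_ge0.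
have [wi_eq1|wi_neq1] := eqVneq (w i) 1.
  have wj j : j != i -> w j = 0.
    move: j; apply: psumr_eq0P => //.
    by apply: (addrI (w i)); rewrite addr0 [RHS]wi_eq1 -w1 [RHS](bigD1 i).
  suff -> : (fun a => \sum_i w i * x i a) = x i by exact: xC.
  apply/funext => a; rewrite (bigD1 i) //= wi_eq1 mul1r big1 ?addr0 // => j ji.
  by rewrite wj // mul0r.
have wi_lt1 : 0 < 1 - w i by rewrite subr_gt0 lt_neqAle wi_neq1.
pose v j := if j == i then 0 else w j / (1 - w i).
have vE (F : I -> R) : \sum_j v j * F j = (\sum_(j | j != i) w j * F j) / (1 - w i).
  rewrite (bigD1 i) //= /v eqxx mul0r add0r mulr_suml; apply: eq_bigr => j /negPf->.
  by rewrite mulrAC.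
have sumwi : \sum_(j | j != i) w j = 1 - w i by rewrite -w1 [in RHS](bigD1 i) //= addrAC subrr add0r.
have Cv : C (fun a => \sum_j v j * x j a).
  apply: (IH (s :\ i)); first by move: sn; rewrite (cardsD1 i s) is_ ltnS.
    split=> [j|j|].
    - by rewrite /v; case: eqP => // _; rewrite divr_ge0 // ltW.
    - rewrite !inE negb_and negbK /v; case: eqP => //= _ /ws ->; exact: mul0r.
    under eq_bigr do rewrite -[v _]mulr1.
    rewrite (vE (fun=> 1)); under eq_bigr do rewrite mulr1.
    by rewrite sumwi divff // gt_eqF.
  by move=> j; rewrite inE => /andP[_]; exact: xC.
have := Cc _ _ (xC i is_) Cv (w i).
have wi01 : (Rle 0 (w i) /\ Rle (w i) 1) by split; apply/RleP => //; exact: ltW.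
move/(_ wi01); congr C; apply/funext => a.
rewrite (vE (x^~ a)) [RHS](bigD1 i) //=.
change (w i * x i a + (1 - w i) * ((\sum_(j | j != i) w j * x j a) / (1 - w i)) =
  w i * x i a + \sum_(j | j != i) w j * x j a).
by rewrite [(1 - w i) * _]mulrC divfK // gt_eqF.
Qed.

End Weights.

Section Coordinates.
Variable d : nat.

(* For [j >= d] this is the junk value 0. *)
Definition coord (x : Pt d) (j : nat) : R :=
  match lt_dec j d with left h => x (Fin.of_nat_lt h) | right _ => 0 end.

Definition mkpt (c : nat -> R) : Pt d := fun a => c (proj1_sig (Fin.to_nat a)).

Lemma coordK x : mkpt (coord x) = x.
Proof.
apply/funext => a; rewrite /mkpt /coord.
case: lt_dec => [h|]; last by case; case: (Fin.to_nat a).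
congr x; rewrite -[RHS]Fin.of_nat_to_nat_inv.
exact: Fin.of_nat_ext.
Qed.

Lemma coord_mkpt c j : (j < d)%N -> coord (mkpt c) j = c j.
Proof.
move=> jd; rewrite /coord /mkpt; case: lt_dec => [h|[]]; last exact/ssrnat.ltP.
by rewrite Fin.to_nat_of_nat.
Qed.

Lemma eq_mkpt (c c' : nat -> R) : (forall j, (j < d)%N -> c j = c' j) -> mkpt c = mkpt c'.
Proof.
by move=> E; apply/funext => a; apply: E; case: (Fin.to_nat a) => j /= /ssrnat.ltP.
Qed.

Lemma sum_coord (I : finType) (w : I -> R) (x : I -> Pt d) :
  (fun a => \sum_i w i * x i a) = mkpt (fun j => \sum_i w i * coord (x i) j).
Proof. by apply/funext => a; apply: eq_bigr => i _; rewrite -[in LHS](coordK (x i)). Qed.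

Lemma crosses_convex (I : finType) (C : PSet d) (x : I -> Pt d) (s : {set I}) c : Defs.convex C ->
  (forall i, i \in s -> C (x i)) -> crosses d c (fun i => coord (x i)) s -> C (mkpt c).
Proof.
move=> Cc xC [w ws wc]; have := convex_weights Cc ws xC; rewrite sum_coord.
by rewrite (@eq_mkpt _ c).
Qed.

End Coordinates.

Section Helly.
Variables (d : nat) (J : finType) (S : J -> PSet d).

Definition common (A : {set J}) (x : Pt d) := forall j, j \in A -> S j x.
Definition inter (A : {set J}) := exists x, common A x.

Lemma common_subset (A B : {set J}) x : A \subset B -> common B x -> common A x.
Proof. by move=> AB Bx j jA; apply: Bx; apply: (subsetP AB). Qed.

Lemma inter_subset (A B : {set J}) : A \subset B -> inter B -> inter A.
Proof. by move=> AB [x Bx]; exists x; exact: common_subset Bx. Qed.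

Hypothesis Sconvex : forall j, Defs.convex (S j).

(** Radon's argument. By induction, x j lies in all members except possibly S j. The positive and
    the remaining coefficients of an affine dependency represent one point in two ways, and for each
    member one of the two uses only points of that member. The dependency is between indices, so
    coinciding points need no separate case. *)
Lemma helly (A : {set J}) :
  (forall B : {set J}, B \subset A -> (#|B| <= d.+1)%N -> inter B) -> inter A.
Proof.
have [n] := ubnP #|A|; elim: n A => // n IH A An hA.
have [Ad|dA] := leqP #|A| d.+1; first exact: hA.
have /fin_all_exists [x xP] : forall j, exists xj : Pt d, j \in A -> common (A :\ j) xj.
  move=> j.
  have [jA|jA] := boolP (j \in A); last by exists (@mkpt d (fun=> 0)).
  have [||y yA] := IH (A :\ j); first by move: An; rewrite (cardsD1 j A) jA ltnS.
    move=> B BA; apply: hA; exact: subset_trans BA (subsetDl _ _).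
  by exists y.
have [l [lA l0 lX [i0 li0]]] := affine_dependency (fun i => coord (x i)) dA.
pose P := [set i | 0 < l i].
pose L := \sum_(i in P) l i.
have L0 : 0 < L.
  rewrite /L (bigD1 i0) ?inE //=; apply: ltr_wpDr => //.
  by apply: sumr_ge0 => i /andP[]; rewrite inE => /ltW.
have splitl (F : J -> R) : \sum_i l i * F i = 0 ->
    \sum_(i in P) l i * F i = \sum_(i in ~: P) - l i * F i.
  rewrite (bigID (mem P)) /= => /eqP; rewrite addr_eq0 => /eqP ->.
  rewrite -sumrN; apply: eq_big => [i|i _]; first by rewrite !inE.
  by rewrite mulNr.
have LN : L = \sum_(i in ~: P) - l i.
  rewrite /L; under eq_bigr do rewrite -[l _]mulr1.
  rewrite (splitl (fun=> 1)); last by under eq_bigr do rewrite mulr1.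
  by under eq_bigr do rewrite mulr1.
pose w i := if i \in P then l i / L else 0.
pose v i := if i \in P then 0 else - l i / L.
have PA i : i \in P -> i \in A.
  by rewrite inE => li; apply/negPn/negP => /lA E; rewrite E ltxx in li.
have wP : weights P w.
  split=> [i|i|]; rewrite /w.
  - by case: ifP; rewrite // inE => /ltW ?; rewrite divr_ge0 // ltW.
  - by move=> /negPf->.
  by rewrite -big_mkcond /= -mulr_suml divff // gt_eqF.
have vP : weights (A :\: P) v.
  split=> [i|i|]; rewrite /v.
  - case: ifP => // /negbT; rewrite inE -leNgt => ?.
    by rewrite divr_ge0 ?oppr_ge0 // ltW.
  - by rewrite in_setD negb_and negbK; case: ifP => //= _ /lA->; rewrite oppr0 mul0r.
  transitivity (\sum_(i in ~: P) - l i / L); last first.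
    by rewrite -mulr_suml -LN divff // gt_eqF.
  by rewrite [RHS]big_mkcond; apply: eq_bigr => i _; rewrite in_setC; case: ifP.
have wv : @mkpt d (fun a => \sum_i w i * coord (x i) a) =
          @mkpt d (fun a => \sum_i v i * coord (x i) a).
  apply: eq_mkpt => a ad.
  transitivity ((\sum_(i in P) l i * coord (x i) a) / L).
    rewrite mulr_suml [RHS]big_mkcond; apply: eq_bigr => i _.
    by rewrite /w; case: ifP => _; rewrite ?mul0r // mulrAC.
  rewrite splitl ?lX // mulr_suml big_mkcond; apply: eq_bigr => i _.
  by rewrite /v in_setC; case: (i \in P); rewrite /= ?mul0r // mulrAC.
exists (@mkpt d (fun a => \sum_i w i * coord (x i) a)) => j jA.
have [jP|jP] := boolP (j \in P).
  rewrite wv -sum_coord; apply: (convex_weights (x := x) (@Sconvex j) vP) => i.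
  rewrite inE => /andP[iP iA]; apply: (xP i iA); rewrite !inE jA andbT.
  by apply: contraNneq iP => <-.
rewrite -sum_coord; apply: (convex_weights (x := x) (@Sconvex j) wP) => i iP.
apply: (xP i (PA i iP)); rewrite !inE jA andbT.
by apply: contraNneq jP => ->.
Qed.

End Helly.

(** * Nearest points of intersections of compact convex sets *)

Section NearestPoint.
Variable d : nat.
Implicit Types (x y z : Pt d) (K Z : PSet d).

Definition sqnorm x := \sum_(j < d) coord x j ^+ 2.

Lemma coord_ord x (j : 'I_d) : exists a : Fin.t d, forall y, coord y j = y a.
Proof.
by exists (Fin.of_nat_lt (elimT ssrnat.ltP (ltn_ord j))) => y; rewrite /coord;
   case: lt_dec => [h|[]]; [congr y; exact: Fin.of_nat_ext | exact/ssrnat.ltP].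
Qed.

Lemma open_sqnorm_gt (a : R) : Defs.open_set (fun x => a < sqnorm x).
Proof.
move=> x ax; pose s := 1 + \sum_(j < d) 2 * `|coord x j|.
have s0 : 0 < s.
  by rewrite ltr_wpDr // sumr_ge0 // => j _; rewrite mulr_ge0.
exists ((sqnorm x - a) / s); split; first by apply/RltP; rewrite divr_gt0 // subr_gt0.
move=> y xy; set r := (sqnorm x - a) / s in xy.
have r0 : 0 < r by rewrite divr_gt0 // subr_gt0.
have rs : r * s = sqnorm x - a by rewrite divfK // gt_eqF.
suff : sqnorm x - r * (s - 1) <= sqnorm y.
  by apply: lt_le_trans; rewrite mulrBr rs; lra.
rewrite /s addrAC subrr add0r mulr_sumr -sumrB; apply: ler_sum => j _.
have [b jb] := coord_ord x j; have := xy b; rewrite -!jb => /RltP.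
rewrite RabsE RminusE => yx.
set u := coord x j; set v := coord y j in yx *.
have := ler_norm (- u * (v - u)); rewrite normrM normrN => H.
have : `|u| * `|v - u| <= `|u| * r by rewrite ler_wpM2l // ltW.
have := sqr_ge0 (v - u); nra.
Qed.

(** K is covered by the sets of points at distance more than 1/(n+1) from x; the largest n in a
    finite subcover gives the radius. *)
Lemma open_complement_compact K : Defs.compact K -> Defs.open_set (fun x => ~ K x).
Proof.
move=> cK x nKx.
pose U (n : nat) : PSet d := fun y => exists a, n.+1%:R^-1 < `|y a - x a|.
have [n||l lP] := cK nat U.
- move=> y [a ya]; exists (`|y a - x a| - n.+1%:R^-1); split.
    by apply/RltP; rewrite subr_gt0.
  move=> z zy; exists a; have /RltP := zy a; rewrite RabsE RminusE => {}zy.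
  have : `|y a - x a| <= `|y a - z a| + `|z a - x a|.
    by rewrite (le_trans _ (ler_normD _ _)) // addrA subrK.
  by rewrite (distrC (y a) (z a)); move: zy; set e := _^-1; lra.
- move=> y Ky; have [a ya] : exists a, y a != x a.
    apply: contrapT => /forallNP yx; apply: nKx; suff <- : y = x by [].
    by apply/funext => a; apply/eqP/negPn/negP/yx.
  have yx0 : 0 < `|y a - x a| by rewrite normr_gt0 subr_eq0.
  have [n] : exists n : nat, `|y a - x a|^-1 < n%:R.
    by exists (Num.trunc `|y a - x a|^-1).+1; rewrite truncnS_gt.
  case: n => [|n yn]; first by rewrite ltNge invr_ge0 ltW.
  by exists n; exists a; rewrite invf_plt ?posrE.
pose n := foldr maxn 0%N l.
exists n.+1%:R^-1; split; first by apply/RltP; rewrite invr_gt0 ltr0n.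
move=> y yx Ky; have [i [il [a ya]]] := lP y Ky.
have /RltP := yx a; rewrite RabsE RminusE => {}yx.
have : n.+1%:R^-1 <= i.+1%:R^-1 :> R.
  rewrite lef_pV2 ?posrE ?ltr0n // ler_nat ltnS /n.
  elim: l il {lP yx n} => //= b l IH [->|/IH]; rewrite leq_max ?leqnn //.
  by move=> ->; rewrite orbT.
by move: yx ya; set e := _^-1; set f := _^-1; lra.
Qed.

(** The minimum is attained by a direct covering argument: without a minimiser, the sets of points
    farther from the origin than some z in K and Z, together with the complement of Z, cover K, yet
    the best of finitely many such z is left uncovered. *)
Lemma compact_nearest_point K Z : Defs.compact K -> Defs.open_set (fun x => ~ Z x) ->
  forall x0, K x0 -> Z x0 ->
  exists y, [/\ K y, Z y & forall z, K z -> Z z -> sqnorm y <= sqnorm z].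
Proof.
move=> cK oZ x0 Kx0 Zx0; apply: contrapT => nmin.
(* The complement of Z is merged into every [U z], so that the points z can be the only indices. *)
pose U z : PSet d := fun x => [/\ K z, Z z & sqnorm z < sqnorm x] \/ ~ Z x.
have [z||l lP] := cK _ U.
- move=> x [[Kz Zz zx]|nZ].
    have [r [r0 rP]] := open_sqnorm_gt zx; exists r; split=> // y /rP ?; by left.
  by have [r [r0 rP]] := oZ _ nZ; exists r; split=> // y /rP ?; right.
- move=> x Kx; have [Zx|nZx] := pselect (Z x); last by exists x; right.
  apply: contrapT => /forallNP H; apply: nmin; exists x; split=> // z Kz Zz.
  by rewrite leNgt; apply/negP => zx; apply: (H z); left.
have [z [Kz Zz zl]] : exists z, [/\ K z, Z z &
    forall y, In y l -> K y -> Z y -> sqnorm z <= sqnorm y].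
  elim: l {lP} => [|y l [z [Kz Zz IH]]]; first by exists x0; split.
  have [[Ky Zy yz]|H] := pselect [/\ K y, Z y & sqnorm y < sqnorm z].
    exists y; split=> // y' /= [<-//|/IH /[apply] /[apply]].
    by apply: le_trans; exact: ltW.
  exists z; split=> // y' /= [<- Ky Zy|]; last exact: IH.
  by rewrite leNgt; apply/negP => yz; apply: H.
have [y [yl [[Ky Zy yz]|]]] := lP z Kz; last by apply.
by move: yz; rewrite ltNge zl.
Qed.

Lemma sqnorm_midpoint x y : sqnorm (mkpt (fun j => 2^-1 * coord x j + (1 - 2^-1) * coord y j)) =
  2^-1 * sqnorm x + 2^-1 * sqnorm y - 4^-1 * \sum_(j < d) (coord x j - coord y j) ^+ 2.
Proof.
rewrite /sqnorm !mulr_sumr -big_split /= -sumrB; apply: eq_bigr => j _.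
rewrite coord_mkpt //.
by field.
Qed.

Lemma sqnorm_convex x y (a : R) : 0 <= a <= 1 ->
  sqnorm (fun i => Rplus (Rmult a (x i)) (Rmult (Rminus 1 a) (y i))) <=
  a * sqnorm x + (1 - a) * sqnorm y.
Proof.
move=> /andP[a0 a1]; rewrite /sqnorm !mulr_sumr -big_split /=; apply: ler_sum => j _.
have [b jb] := coord_ord x j; rewrite !jb RplusE !RmultE RminusE.
have := mulr_ge0 (mulr_ge0 a0 (_ : 0 <= 1 - a)) (sqr_ge0 (x b - y b)).
by rewrite subr_ge0 => /(_ a1); rewrite (_ : IZR 1 = 1) //; nra.
Qed.

Variables (J : finType) (S : J -> PSet d).
Hypotheses (Sconvex : forall j, Defs.convex (S j)) (Scompact : forall j, Defs.compact (S j)).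
Implicit Types (A B C D : {set J}).

Definition nearest A y := common S A y /\ forall z, common S A z -> sqnorm y <= sqnorm z.

Lemma nearest_exists A : A != set0 -> inter S A -> exists y, nearest A y.
Proof.
case/set0Pn => j jA [x Ax].
have [|y [Ky Zy yP]] := compact_nearest_point (@Scompact j) (Z := common S A) _ (Ax j jA) Ax.
  move=> z nZ; have [i iA niz] : exists2 i, i \in A & ~ S i z.
    apply: contrapT => H; apply: nZ => i iA; apply: contrapT => Hi.
    by apply: H; exists i.
  have [r [r0 rP]] := open_complement_compact (@Scompact i) niz.
  by exists r; split=> // y /rP nS /(_ i iA).
by exists y; split=> // z Az; apply: yP => //; exact: Az.
Qed.

Lemma nearest_unique A x y : nearest A x -> nearest A y -> x = y.
Proof.
move=> [Ax xP] [Ay yP].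
have xy : sqnorm x = sqnorm y by apply: le_anti; rewrite xP // yP.
pose m : Pt d := mkpt (fun j => 2^-1 * coord x j + (1 - 2^-1) * coord y j).
have Am : common S A m.
  move=> j jA; have /andP[h0 h1] : 0 <= (2^-1 : R) <= 1 by apply/andP; split; lra.
  have := @Sconvex j x y (Ax j jA) (Ay j jA) _ (conj (elimT RleP h0) (elimT RleP h1)).
  by rewrite -[in X in X -> _](coordK x) -[in X in X -> _](coordK y).
have := xP m Am; rewrite sqnorm_midpoint -xy => H.
have s0 : \sum_(j < d) (coord x j - coord y j) ^+ 2 = 0.
  have s0 : 0 <= \sum_(j < d) (coord x j - coord y j) ^+ 2.
    by apply: sumr_ge0 => j _; exact: sqr_ge0.
  by apply: le_anti; rewrite s0 andbT; lra.
rewrite -(coordK x) -(coordK y); apply: eq_mkpt => j jd.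
apply/eqP; rewrite -subr_eq0 -sqrf_eq0; apply/eqP.
apply: (psumr_eq0P _ s0 (i := Ordinal jd)) => // i _; exact: sqr_ge0.
Qed.

Lemma nearest_between A B C y : A \subset B -> B \subset C ->
  nearest A y -> common S C y -> nearest B y.
Proof.
move=> AB BC [_ yP] Cy; split; first exact: common_subset Cy.
by move=> z Bz; apply: yP; exact: common_subset Bz.
Qed.

(* Helly's theorem, applied to the members of [A] and the open ball of radius |y|. *)
Lemma nearest_basis A y : (0 < d)%N -> A != set0 -> nearest A y ->
  exists D, [/\ D \subset A, D != set0, (#|D| <= d)%N & nearest D y].
Proof.
move=> d0 A0 [Ay yP].
pose B : option J -> PSet d := fun o => if o is Some j then S j else fun z => sqnorm z < sqnorm y.
have Bconvex o : Defs.convex (B o).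
  case: o => [j|] /=; first exact: (@Sconvex j).
  move=> u v uy vy a [/RleP a0 /RleP a1]; apply: le_lt_trans (sqnorm_convex _ _ _) _.
    by apply/andP.
  have {}a0 : 0 <= a by []. have {}a1 : a <= 1 by [].
  move: uy vy => /=; move: (sqnorm u) (sqnorm v) (sqnorm y) => p q r pr qr.
  have [->|an0] := eqVneq a 0; first by rewrite mul0r add0r subr0 mul1r.
  have : 0 < a * (r - p) by rewrite mulr_gt0 ?subr_gt0 // lt_neqAle eq_sym an0.
  have : 0 <= (1 - a) * (r - q) by rewrite mulr_ge0 ?subr_ge0 // ltW.
  by move=> ? ?; nra.
have [[x xP]|nint] := pselect (inter B (None |: [set Some j | j in A])).
  have : sqnorm x < sqnorm y by apply: (xP None); rewrite !inE.
  rewrite ltNge yP // => j jA; apply: (xP (Some j)).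
  by rewrite !inE imset_f.
have [E [EA Ed nE]] : exists E : {set option J},
    [/\ E \subset None |: [set Some j | j in A], (#|E| <= d.+1)%N & ~ inter B E].
  apply: contrapT => H; apply: nint; apply: (helly Bconvex) => E EA Ed.
  by apply: contrapT => nE; apply: H; exists E.
pose D0 := [set j in A | Some j \in E].
(* The point y lies in all members, so a family without common point must contain the ball; this
   lowers Helly's d + 1 to d members of A. *)
have NE : None \in E.
  apply/negPn/negP => NE; apply: nE; exists y => -[j|] jE; last by rewrite jE in NE.
  have := subsetP EA _ jE; rewrite !inE /= => /imsetP[i iA [->]]; exact: Ay.
have D0d : (#|D0| <= d)%N.
  have : (#|Some @: D0| <= #|E :\ None|)%N.
    apply/subset_leq_card/subsetP => o /imsetP[j]; rewrite inE => /andP[_ jE] ->.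
    by rewrite !inE.
  rewrite card_imset; last by move=> ? ? [].
  by move: Ed; rewrite (cardsD1 None E) NE add1n ltnS => /[swap]; exact: leq_trans.
have key D : D0 \subset D -> D \subset A -> nearest D y.
  move=> D0D DA; split; first exact: common_subset Ay.
  move=> z Dz; rewrite leNgt; apply/negP => zy; apply: nE; exists z => -[j|//] jE.
  apply: Dz; apply: (subsetP D0D); rewrite inE jE andbT.
  by have := subsetP EA _ jE; rewrite !inE /= => /imsetP[i iA [->]].
have D0A : D0 \subset A by apply/subsetP => j; rewrite inE => /andP[].
have [D00|D0n] := eqVneq D0 set0; last by exists D0; split=> //; exact: key.
case/set0Pn: A0 => j jA; exists [set j]; split.
- by rewrite sub1set.
- by apply/set0Pn; exists j; rewrite inE.
- by rewrite cards1.
- by apply: key; rewrite ?D00 ?sub0set ?sub1set.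
Qed.

End NearestPoint.

(** * The Hadwiger-Debrunner theorem *)

Lemma length_size T (s : seq T) : length s = size s.
Proof. by elim: s => //= x s ->. Qed.

Lemma In_map (U : eqType) T (f : U -> T) (s : seq U) u : u \in s -> In (f u) (map f s).
Proof. by elim: s => //= v s IH; rewrite inE => /orP[/eqP->|/IH]; [left|right]. Qed.

Section Piercing.
Variables (d : nat) (J : finType) (S : J -> PSet d).
Implicit Types (A B D G I : {set J}) (T : list (Pt d)).

Definition pierces T A := forall j, j \in A -> exists x, In x T /\ S j x.

Lemma pierces_cat T T' A B : pierces T A -> pierces T' B -> pierces (T ++ T')%list (A :|: B).
Proof.
move=> TA TB j; rewrite inE => /orP[/TA|/TB] [x [xT Sx]]; exists x; split=> //;
  apply/in_app_iff; [by left|by right].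
Qed.

Hypothesis S0 : forall j, exists x, S j x.

Lemma pierces_card A : exists2 T, (length T <= #|A|)%N & pierces T A.
Proof.
have [x xP] := fin_all_exists S0.
exists (map x (enum A)); first by rewrite length_size size_map cardE.
by move=> j jA; exists (x j); split=> //; apply: In_map; rewrite mem_enum.
Qed.

Lemma pierces_inter A I : I \subset A -> inter S I ->
  exists2 T, (length T + #|I| <= #|A|.+1)%N & pierces T A.
Proof.
move=> IA [x Ix]; have [T Tl TA] := pierces_card (A :\: I).
exists (x :: T).
  by have := cardsID I A; rewrite (setIidPr IA) /=; lia.
rewrite -(setID A I) (setIidPr IA); apply: (pierces_cat (T := [:: x])) => // j jI.
by exists x; split; [left | exact: Ix].
Qed.

End Piercing.

Section HadwigerDebrunner.
Variables (d : nat) (J : finType) (S : J -> PSet d).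
Hypotheses (Sconvex : forall j, Defs.convex (S j)) (Scompact : forall j, Defs.compact (S j)).
Hypotheses (S0 : forall j, exists x, S j x) (d0 : (0 < d)%N).
Implicit Types (A B D G I : {set J}) (T : list (Pt d)).

(* The point x of a small intersecting subfamily D that is farthest from the
   origin: any intersecting family containing D has x as its nearest point. *)
Lemma farthest_nearest_point A : A != set0 -> exists D x,
  [/\ D \subset A, (#|D| <= d)%N, D != set0, common S D x &
      forall I, D \subset I -> I \subset A -> inter S I -> common S I x].
Proof.
case/set0Pn => j jA.
have /fin_all_exists [Y YP] : forall D, exists y, D != set0 -> inter S D -> nearest S D y.
  move=> D; have [[Dn Di]|H] := pselect (D != set0 /\ inter S D).
    by have [y yP] := nearest_exists Scompact Dn Di; exists y.
  by exists (mkpt (fun=> 0)) => Dn Di; case: H.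
pose P D := [&& D \subset A, #|D| <= d, D != set0 & `[< inter S D >]]%N.
have Pj : P [set j].
  rewrite /P sub1set jA cards1 d0 /=; apply/andP; split.
    by apply/set0Pn; exists j; rewrite inE.
  by apply/asboolP; have [x Sx] := S0 j; exists x => i; rewrite inE => /eqP->.
case: (@arg_maxP _ _ _ [set j] P (fun D => sqnorm (Y D)) Pj) => D /and4P[DA Dd Dn /asboolP Di] Dmax.
have DY := YP D Dn Di; exists D, (Y D); split=> //; first by case: DY.
move=> I DI IA Ii.
have In : I != set0 by apply: contraNneq Dn => E; rewrite -subset0 -E.
have [y Iy] := nearest_exists Scompact In Ii.
have [D1 [D1I D1n D1d D1y]] := nearest_basis Sconvex d0 In Iy.
have D1i : inter S D1 by exact: inter_subset Ii.
have yx : sqnorm y <= sqnorm (Y D).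
  rewrite (nearest_unique Sconvex D1y (YP D1 D1n D1i)); apply: Dmax.
  by rewrite /P (subset_trans D1I IA) D1d D1n; apply/asboolP.
suff -> : Y D = y by case: Iy.
apply: (nearest_unique Sconvex DY); split; first exact: common_subset Iy.1.
by move=> z Dz; apply: le_trans yx _; apply: DY.2.
Qed.

(** Here m plays the role of p - q + 1. Induction on m: the point x of [farthest_nearest_point] is
    used, and the members missing it satisfy the hypothesis for m - 1. To see this for G, apply the
    hypothesis to the union of G with D, which costs d in size; an intersecting I with a member in G
    cannot contain all of D, so dropping D loses at most |D| - 1 members. *)
Lemma hadwiger_debrunner m A :
  (forall G, G \subset A -> G != set0 -> (#|G| <= d * m + 1)%N ->
     exists I, [/\ I \subset G, inter S I & (#|G| < #|I| + m)%N]) ->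
  exists2 T, (length T <= m)%N & pierces S T A.
Proof.
elim: m A => [|m IH] A hA.
  exists nil => // j jA; have [|||I [Ij _]] := hA [set j].
  - by rewrite sub1set.
  - by apply/set0Pn; exists j; rewrite inE.
  - by rewrite cards1 muln0.
  by have := subset_leq_card Ij; rewrite cards1; lia.
have [->|An] := eqVneq A set0; first by exists nil => // j; rewrite inE.
have [D [x [DA Dd Dn Dx Dmax]]] := farthest_nearest_point An.
pose A' := [set j in A | ~~ `[< S j x >]].
have [|T Tm TA'] := IH A'; last first.
- exists (x :: T) => // j jA; have [jx|jx] := boolP `[< S j x >].
    by exists x; split; [left | exact/asboolP].
  by have [|y [yT Sy]] := TA' j; [rewrite inE jA | exists y; split; [right|]].
move=> G GA' Gn Gm.
have GD : [disjoint G & D].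
  rewrite disjoint_subset; apply/subsetP => j /(subsetP GA').
  rewrite !inE => /andP[_]; apply: contra => jD; apply/asboolP; exact: Dx.
have cGD : #|G :|: D| = (#|G| + #|D|)%N by rewrite cardsU disjoint_setI0 // cards0 subn0.
have GA : G \subset A by apply: subset_trans GA' _; apply/subsetP => j; rewrite inE => /andP[].
have [|||I [IG Ii Im]] := hA (G :|: D).
- by rewrite subUset GA.
- by apply: contraNneq Gn => E; rewrite -subset0 -E subsetUl.
- by rewrite cGD; move: Gm Dd; rewrite mulnS; lia.
(* If I contains D, then x lies in all of I, so I has no member in G and |G| <= m follows. A single
   member of G is then enough. *)
have [DI|DI] := boolP (D \subset I).
  have Ix := Dmax I DI (subset_trans IG _) Ii.
  have ID : I \subset D.
    apply/subsetP => j jI; have := subsetP IG j jI; rewrite inE => /orP[/(subsetP GA')|//].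
    rewrite inE => /andP[_ /asboolP[]]; apply: Ix => //.
    by rewrite subUset GA.
  have [j jG] := set0Pn _ Gn; exists [set j]; split.
  - by rewrite sub1set.
  - by have [z Sz] := S0 j; exists z => i; rewrite inE => /eqP->.
  - by rewrite cards1; have := subset_leq_card ID; lia.
exists (I :&: G); split; first exact: subsetIr.
  by apply: inter_subset Ii; exact: subsetIl.
have : (#|I :\: G| < #|D|)%N.
  apply: proper_card; rewrite properE; apply/andP; split.
    apply/subsetP => j; rewrite inE => /andP[jG /(subsetP IG)]; rewrite inE.
    by rewrite (negPf jG).
  by apply: contra DI => /subset_trans; apply; exact: subsetDl.
by have := cardsID G I; lia.
Qed.

End HadwigerDebrunner.

(** * Fractional Helly *)

Lemma bin_le_expn n k : ('C(n, k) <= n ^ k)%N.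
Proof.
apply: (@leq_trans (n ^_ k)); first by rewrite -bin_ffact leq_pmulr // fact_gt0.
by elim: k => // k IH; rewrite ffactnSr expnSr leq_mul // leq_subr.
Qed.

Lemma card_le_fibers (U V : finType) (A : {set U}) (f : U -> V) (W : {set V}) k :
  (forall u, u \in A -> f u \in W) ->
  (forall w, w \in W -> #|[set u in A | f u == w]| <= k)%N -> (#|A| <= #|W| * k)%N.
Proof.
move=> fW fk; rewrite -sum1_card (partition_big f (mem W)) //= -sum_nat_const.
by apply: leq_sum => w /fk; rewrite sum1dep_card.
Qed.

Section FractionalHelly.
Variables (d : nat) (J : finType) (S : J -> PSet d).
Hypotheses (Sconvex : forall j, Defs.convex (S j)) (Scompact : forall j, Defs.compact (S j)).
Hypothesis d0 : (0 < d)%N.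
Variables (Y : finType) (phi : Y -> J) (N : nat).

Let SZ (z : {ffun 'I_N -> Y}) (i : 'I_N) := S (phi (z i)).

(** [Y] lists copies of the members, so that weights become multiplicities. Samples are functions,
    with repetition allowed, so that they can be counted coordinate by coordinate. *)
Definition sees_nearest (P D : {set 'I_N}) := [set z : {ffun 'I_N -> Y} |
  `[< exists2 x, nearest (SZ z) D x & common (SZ z) P x >]].

Definition depth (x : Pt d) := #|[set y | `[< S (phi y) x >]]|.

Lemma common_agree (z z' : {ffun 'I_N -> Y}) (D : {set 'I_N}) x :
  {in D, z =1 z'} -> common (SZ z) D x -> common (SZ z') D x.
Proof. by move=> zz' Dx i iD; rewrite /SZ -zz' //; exact: Dx. Qed.

Lemma nearest_agree (z z' : {ffun 'I_N -> Y}) (D : {set 'I_N}) x :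
  {in D, z =1 z'} -> nearest (SZ z) D x -> nearest (SZ z') D x.
Proof.
move=> zz' [Dx xP]; split; first exact: common_agree Dx.
by move=> y Dy; apply: xP; apply: common_agree Dy => i iD; rewrite zz'.
Qed.

(* The nearest point is determined by the coordinates in D; once it is fixed,
   each coordinate in P has at most [m] possible values. *)
Lemma card_sees_nearest m (P D : {set 'I_N}) : (forall x, depth x <= m)%N -> [disjoint P & D] ->
  (#|sees_nearest P D| <= #|Y| ^ (N - #|P|) * m ^ #|P|)%N.
Proof.
move=> dm PD; have [P0|/set0Pn[i0 i0P]] := eqVneq P set0.
  by rewrite P0 cards0 muln1 subn0 (leq_trans (max_card _)) // card_ffun card_ord.
have [->|/set0Pn[z0 z0B]] := eqVneq (sees_nearest P D) set0; first by rewrite cards0.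
(* [r] erases the coordinates in P, and [e] below erases the others; [y0] is only a filler value. *)
pose y0 := z0 i0; pose r (z : {ffun 'I_N -> Y}) := [ffun i => if i \in P then y0 else z i].
pose W := [set w in pffun_on y0 (mem (~: P)) (mem [set: Y])].
have -> : (#|Y| ^ (N - #|P|))%N = #|W|.
  rewrite cardsE card_pffun_on cardsT; congr (_ ^ _)%N.
  by rewrite -[RHS]/#|~: P|; have := cardsC P; rewrite card_ord; lia.
apply: (card_le_fibers (f := r)) => [z _|w _].
  rewrite inE; apply/pffun_onP; split; last by move=> _ /imageP[i _ ->]; rewrite inE.
  by apply/supportP => i; rewrite inE negbK ffunE => ->.
set B := [set _ in _ | _]; have [->|/set0Pn[z1]] := eqVneq B set0; first by rewrite cards0.
rewrite !inE => /andP[/asboolP[x Dx _] /eqP z1w].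
have agree z z' : r z = w -> r z' = w -> forall i, i \notin P -> z i = z' i.
  by move=> <- /ffunP zz' i /negPf iP; have := zz' i; rewrite !ffunE iP.
apply: (@leq_trans #|[set u in pffun_on y0 (mem P) (mem [set y | `[< S (phi y) x >]])]|); last first.
  by rewrite cardsE card_pffun_on leq_exp2r ?card_gt0 //; [exact: dm | apply/set0Pn; exists i0].
pose e (z : {ffun 'I_N -> Y}) := [ffun i => if i \in P then z i else y0].
rewrite -(@card_in_imset _ _ e); last first.
  move=> z z'; rewrite !inE => /andP[_ /eqP zw] /andP[_ /eqP z'w] /ffunP zz'.
  apply/ffunP => i; have := zz' i; rewrite !ffunE; case: ifPn => // iP _.
  exact: agree iP.
apply/subset_leq_card/subsetP => _ /imsetP[z + ->].
rewrite !inE => /andP[/asboolP[x' Dx' Px'] /eqP zw].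
have DP i : i \in D -> i \notin P.
  by move=> iD; apply/negP => iP; have := disjointFr PD iP; rewrite iD.
have xx' : x' = x.
  apply: (nearest_unique _ Dx') => //; first by move=> i; exact: Sconvex.
  by apply: nearest_agree Dx => i /DP iP; exact: agree iP.
apply/pffun_onP; split.
  by apply/supportP => i iP; rewrite ffunE (negPf iP).
by move=> _ /imageP[i iP ->]; rewrite ffunE iP inE; apply/asboolP; rewrite -xx'; exact: Px'.
Qed.

(** A union bound. In every sample, Q intersecting members have a nearest point determined by d of
    them and lying in the other Q - d. There are at most N^Q choices of these positions, and
    [card_sees_nearest] bounds the samples for each. So some depth is at least about |Y| /
    N^(Q/(Q-d)). *)
Lemma fractional_helly m Q : (d < Q)%N -> (forall x, depth x <= m)%N ->
  (forall z : {ffun 'I_N -> Y}, exists q : {set 'I_N}, #|q| = Q /\ inter (SZ z) q) ->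
  (#|Y| ^ (Q - d) <= N ^ Q * m ^ (Q - d))%N.
Proof.
move=> dQ dm hz.
have [Y0|Y0] := posnP #|Y|; first by rewrite Y0 exp0n ?subn_gt0.
have QN : (Q <= N)%N.
  have [y _] := card_gt0P Y0; have [q [<- _]] := hz [ffun=> y].
  by rewrite -[X in (_ <= X)%N]card_ord max_card.
pose k := (Q - d)%N.
pose W := [set PD : {set 'I_N} * {set 'I_N} | [&& #|PD.1| == k, #|PD.2| == d & [disjoint PD.1 & PD.2]]].
have cW : (#|W| <= N ^ Q)%N.
  apply: (@leq_trans #|setX [set P : {set 'I_N} | #|P| == k] [set D : {set 'I_N} | #|D| == d]|).
    by apply/subset_leq_card/subsetP => PD; rewrite !inE => /and3P[-> ->].
  rewrite cardsX !card_draws card_ord -(subnK (ltnW dQ)) expnD.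
  by rewrite leq_mul // bin_le_expn.
have cover : [set: {ffun 'I_N -> Y}] \subset \bigcup_(PD in W) sees_nearest PD.1 PD.2.
  apply/subsetP => z _; have [q [qQ qi]] := hz z.
  have qn : q != set0 by rewrite -card_gt0 qQ; lia.
  have [x xq] := nearest_exists (fun i => @Scompact _) qn qi.
  have [D0 [D0q _ D0d D0x]] := nearest_basis (fun i => @Sconvex _) d0 qn xq.
  (* The basis is filled up to exactly d positions inside q; by [nearest_between] the nearest point
     stays the same. *)
  have [|D [D0D Dq Dd]] := @subset_extend _ D0 q d D0q; first by rewrite D0d qQ ltnW.
  apply/bigcupP; exists (q :\: D, D) => /=.
    rewrite inE /= cardsD (setIidPr Dq) qQ Dd !eqxx /=.
    by rewrite -setI_eq0 setDE -setIA (setIC _ D) setICr setI0.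
  rewrite inE; apply/asboolP; exists x.
    by apply: (nearest_between D0D Dq D0x); case: xq.
  by apply: (common_subset (subsetDl q D)); case: xq.
have : (#|Y| ^ N <= N ^ Q * (#|Y| ^ (N - k) * m ^ k))%N.
  have -> : (#|Y| ^ N = #|[set: {ffun 'I_N -> Y}]|)%N by rewrite cardsT card_ffun card_ord.
  apply: leq_trans (subset_leq_card cover) _.
  apply: (@leq_trans (\sum_(PD in W) #|sees_nearest PD.1 PD.2|)).
    by elim/big_rec2: _ => [|PD a A _ IH]; rewrite ?cards0 // (leq_trans (leq_card_setU _ _)) // leq_add2l.
  apply: (@leq_trans (\sum_(PD in W) #|Y| ^ (N - k) * m ^ k)); last first.
    by rewrite sum_nat_const leq_mul2r cW orbT.
  apply: leq_sum => -[P D]; rewrite inE /= => /and3P[/eqP Pk _ PD].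
  by rewrite -Pk; exact: card_sees_nearest.
rewrite -{1}(@subnK k N); last by rewrite (leq_trans _ QN) // leq_subr.
by rewrite expnD mulnCA leq_pmul2l // expn_gt0 Y0.
Qed.

End FractionalHelly.

(** * Fractional transversals by multiplicative weights *)

(** Bernoulli's inequality for 1 + 1/a, cleared of denominators; [expn3_ge] is the same for 3/2. *)
Lemma expn_succ_ge a n : (a ^ n * (a + n.+1) <= a.+1 ^ n.+1)%N.
Proof.
elim: n => [|n IH]; first by rewrite expn0 expn1; lia.
rewrite expnS [X in (_ <= X)%N]expnS.
apply: (@leq_trans (a.+1 * (a ^ n * (a + n.+1)))); last by rewrite leq_mul2l IH.
by nia.
Qed.

Lemma leq_expn2r m n e : (m <= n)%N -> (m ^ e <= n ^ e)%N.
Proof. by case: e => // e mn; rewrite leq_exp2r. Qed.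

Lemma expn3_ge L : (2 ^ L * (L + 2) <= 2 * 3 ^ L)%N.
Proof. by elim: L => // L; rewrite !expnS; nia. Qed.

Section MultiplicativeWeights.
Variables (J : finType) (X : Type) (hit : J -> X -> bool) (A : {set J}) (B : nat).
Hypothesis B0 : (0 < B)%N.
Hypothesis heavy : forall w : J -> nat, exists x,
  (\sum_(j in A) w j <= B * \sum_(j in A | hit j x) w j)%N.

(** The weight of a member is halved whenever it is hit, and the scaling by 2^n keeps it an integer.
    A point that hits a fraction 1/B of the weight lowers the total by the factor 1 - 1/(2B). *)
Lemma multiplicative_weights n : exists xs : seq X, size xs = n /\
  (B ^ n * \sum_(j in A) 2 ^ (n - count (hit j) xs) <= #|A| * (2 * B - 1) ^ n)%N.
Proof.
elim: n => [|n [xs [xsn IH]]].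
  by exists [::]; rewrite !expn0 mul1n muln1 sum_nat_const muln1.
pose w j := (2 ^ (n - count (hit j) xs))%N.
have [x xP] := heavy w; exists (x :: xs); rewrite /= xsn; split=> //.
have -> : (\sum_(j in A) 2 ^ (n.+1 - (hit j x + count (hit j) xs)) =
           2 * \sum_(j in A) w j - \sum_(j in A | hit j x) w j)%N.
  rewrite (bigID (hit^~ x)) /= [in RHS](bigID (hit^~ x)) /=.
  rewrite (eq_bigr w) => [|j /andP[_ ->]]; last by rewrite add1n subSS.
  rewrite [X in (_ + X)%N](eq_bigr (fun j => 2 * w j)%N) => [|j /andP[_ /negPf->]]; last first.
    by rewrite add0n subSn ?expnS // -xsn count_size.
  by rewrite -big_distrr /=; lia.
have step : (B * (2 * \sum_(j in A) w j - \sum_(j in A | hit j x) w j) <=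
   (2 * B - 1) * \sum_(j in A) w j)%N.
  by move: xP; set u := \sum_(_ in _) _; set v := \sum_(_ | _) _; nia.
apply: (@leq_trans (B ^ n * ((2 * B - 1) * \sum_(j in A) w j))).
  by rewrite expnSr -mulnA leq_mul2l step orbT.
by rewrite mulnCA expnS [X in (_ <= X)%N]mulnCA leq_mul2l IH orbT.
Qed.

(** In 4 B rounds the total weight falls by a factor 3, while a single member loses a factor 2 per
    hit. After 4 B L rounds a member with fewer than L hits would be too heavy, since (3/2)^L
    exceeds |A|. L remains free because the weak net needs it large; the ratio 4 B does not depend
    on it. *)
Lemma fractional_transversal : exists L0, forall L, (L0 <= L)%N ->
  exists xs : seq X, size xs = (4 * B * L)%N /\ forall j, j \in A -> (L <= count (hit j) xs)%N.
Proof.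
exists (2 * #|A|)%N => L AL.
have [xs [xsn W]] := multiplicative_weights (4 * B * L).
exists xs; split=> // j jA; set n := (4 * B * L)%N in xsn W.
set c := count _ _; have cn : (c <= n)%N by rewrite -xsn count_size.
have e2 : ((2 * B) ^ n <= 2 ^ c * (#|A| * (2 * B - 1) ^ n))%N.
  rewrite (_ : (2 * B) ^ n = 2 ^ c * (B ^ n * 2 ^ (n - c)))%N; last first.
    by rewrite mulnCA -expnD subnKC // -expnMn mulnC.
  rewrite leq_mul2l (leq_trans _ W) ?orbT // leq_mul2l (bigD1 j) //= leq_addr orbT //.
have e3 : (3 * (2 * B - 1) ^ (4 * B) <= (2 * B) ^ (4 * B))%N.
  have := expn_succ_ge (2 * B - 1) (4 * B).-1.
  rewrite (_ : (2 * B - 1).+1 = (2 * B)%N); last lia.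
  rewrite (_ : (4 * B).-1.+1 = (4 * B)%N); last lia.
  apply: leq_trans; rewrite -[in X in (X <= _)%N](prednK (_ : 0 < 4 * B)%N) ?expnSr; last lia.
  by rewrite mulnCA leq_mul2l; apply/orP; right; lia.
have e4 : (3 ^ L * (2 * B - 1) ^ n <= (2 * B) ^ n)%N.
  by rewrite /n ![(_ ^ (4 * B * L))%N]expnM -expnMn leq_expn2r.
have : (3 ^ L <= 2 ^ c * #|A|)%N.
  have a0 : (0 < (2 * B - 1) ^ n)%N by rewrite expn_gt0; lia.
  by rewrite -(leq_pmul2r a0) -mulnA (leq_trans e4).
have A0 : (0 < #|A|)%N by apply/card_gt0P; exists j.
rewrite [(L <= c)%N]leqNgt; apply: contraL => cL; rewrite -ltnNge.
have : (2 ^ c * 2 <= 2 ^ L)%N by rewrite -expnSr leq_pexp2l.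
have := expn3_ge L; have : (0 < 3 ^ L)%N by rewrite expn_gt0.
move: (3 ^ L)%N (2 ^ c)%N (2 ^ L)%N => t u v; nia.
Qed.

End MultiplicativeWeights.

(** * Points of large weight *)

Section HeavyPoint.
Variables (d : nat) (J : finType) (S : J -> PSet d).
Hypotheses (Sconvex : forall j, Defs.convex (S j)) (Scompact : forall j, Defs.compact (S j)).
Hypotheses (S0 : forall j, exists x, S j x) (d0 : (0 < d)%N).
Variables (p Q B : nat) (A : {set J}).
Hypothesis dQ : (d < Q)%N.
Hypothesis pqA : forall G : {set J}, G \subset A -> #|G| = p ->
  exists I : {set J}, [/\ I \subset G, inter S I & (Q <= #|I|)%N].

(** Either the sample has p distinct members, to which the hypothesis applies, or by pigeonhole some
    nonempty member occurs Q times and intersects itself. *)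
Lemma sample_inter (f : 'I_(p * Q) -> J) : (forall i, f i \in A) ->
  exists q : {set 'I_(p * Q)}, #|q| = Q /\ inter (S \o f) q.
Proof.
move=> fA; have [pim|imp] := leqP p #|f @: setT|.
  have [|G [_ Gim Gp]] := @subset_extend _ set0 (f @: setT) p (sub0set _).
    by rewrite cards0.
  have [|I [IG [x Ix] QI]] := pqA _ Gp.
    by apply: subset_trans Gim _; apply/subsetP => _ /imsetP[i _ ->].
  have [|I' [_ I'I I'Q]] := @subset_extend _ set0 I Q (sub0set _); first by rewrite cards0.
  have /fin_all_exists [g gP] : forall j, exists i, j \in I' -> f i = j.
    move=> j; have [jI|jI] := boolP (j \in I').
      have /imsetP[i _ ->] := subsetP Gim _ (subsetP IG _ (subsetP I'I _ jI)).
      by exists i.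
    have [j' j'I] : exists j', j' \in I' by apply/card_gt0P; rewrite I'Q; lia.
    have /imsetP[i _ _] := subsetP Gim _ (subsetP IG _ (subsetP I'I _ j'I)).
    by exists i.
  exists (g @: I'); split.
    by rewrite card_in_imset // => j j' jI j'I gg; rewrite -(gP j) // gg gP.
  exists x => _ /imsetP[j jI ->] /=; rewrite gP //; apply: Ix; exact: (subsetP I'I).
have [j Qj] : exists j, (Q <= #|[set i | f i == j]|)%N.
  apply: contrapT => /forallNP small.
  have : (#|[set: 'I_(p * Q)]| <= #|f @: setT| * Q.-1)%N.
    apply: (card_le_fibers (f := f)) => [i _|j _]; first exact: imset_f.
    rewrite (_ : [set _ in _ | _] = [set i | f i == j]); last by apply/setP => i; rewrite !inE.
    by have /negP := small j; rewrite -ltnNge; lia.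
  by rewrite cardsT card_ord; nia.
have [|q [_ qj qQ]] := @subset_extend _ set0 [set i | f i == j] Q (sub0set _).
  by rewrite cards0.
exists q; split=> //; have [x Sx] := S0 j; exists x => i /(subsetP qj).
by rewrite inE /= => /eqP->.
Qed.

Hypothesis BQ : ((p * Q) ^ Q <= B ^ (Q - d))%N.

(** [Y] contains w j copies of each member j of A. If every point had depth less than n / B,
    fractional Helly would give n^(Q-d) <= (n-1)^(Q-d). *)
Lemma heavy_point (w : J -> nat) : exists x,
  (\sum_(j in A) w j <= B * \sum_(j in A | `[< S j x >]) w j)%N.
Proof.
pose v j := if j \in A then w j else 0%N.
pose Y : finType := {j : J & 'I_(v j)}; pose phi (y : Y) := tag y.
have cY (P : pred J) : #|[set y : Y | P (phi y)]| = (\sum_(j in A | P j) w j)%N.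
  transitivity (\sum_(j | P j) \sum_(k < v j) 1)%N.
    rewrite (sig_big_dep (J := fun j => 'I_(v j)) P (fun _ => predT) (fun _ _ => 1%N)) -sum1_card.
    by apply: eq_bigl => y; rewrite inE andbT.
  rewrite big_mkcondl; apply: eq_bigr => j _.
  by rewrite sum_nat_const card_ord muln1.
have phiA y : phi y \in A.
  by case: y => j k; rewrite /phi /=; case: k; rewrite /v; case: ifP.
apply: contrapT => /forallNP light.
pose n := #|Y|; have nE : n = (\sum_(j in A) w j)%N.
  rewrite -(eq_bigl _ _ (fun j => andbT (j \in A))) -(cY predT) /n -cardsT.
  by apply: eq_card => y; rewrite !inE.
have lt_n x : (B * depth S phi x < n)%N.
  by rewrite ltnNge; apply/negP; rewrite /depth (cY (fun j => `[< S j x >])) nE; exact: light.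
have n0 : (0 < n)%N by apply: leq_ltn_trans (lt_n (mkpt (fun=> 0))).
have k0 : (0 < Q - d)%N by rewrite subn_gt0.
have B0 : (0 < B)%N.
  rewrite lt0n; apply/eqP => E; move: BQ; rewrite E exp0n // leqn0 expn_eq0 muln_eq0.
  have [y _] := card_gt0P n0.
  case/andP=> /orP[/eqP p0|/eqP Q0 _]; last by move: dQ; rewrite Q0.
  have [I [+ _ QI]] := @pqA set0 (sub0set _) (etrans (cards0 _) (esym p0)).
  by rewrite subset0 => /eqP I0; move: QI; rewrite I0 cards0; lia.
have dm x : (depth S phi x <= n.-1 %/ B)%N.
  by rewrite leq_divRL // mulnC -ltnS prednK.
have := fractional_helly Sconvex Scompact d0 dQ dm (fun z => sample_inter (fun i => phiA (z i))).
apply/negP; rewrite -ltnNge.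
apply: (@leq_ltn_trans (B ^ (Q - d) * (n.-1 %/ B) ^ (Q - d))).
  by rewrite leq_mul2r BQ orbT.
rewrite -expnMn ltn_exp2r // mulnC (leq_ltn_trans (leq_trunc_div _ _)) //.
by rewrite prednK.
Qed.

End HeavyPoint.

(** * Balanced nodes of a tree of slabs *)

Section OrderedPartition.
Variables (U : finType) (f : U -> R).

Lemma ordered_partition (V : {set U}) w : (0 < w)%N -> exists g : U -> nat,
  [/\ forall u v, u \in V -> v \in V -> (g u < g v)%N -> f u <= f v,
      forall i, (#|[set v in V | g v == i]| <= w)%N &
      forall v, v \in V -> (g v * w < #|V|)%N].
Proof.
move=> w0; pose s := sort (relpre f <=%O) (enum V).
have sV v : (v \in s) = (v \in V) by rewrite mem_sort mem_enum.
have s_size : size s = #|V| by rewrite size_sort cardE.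
have s_sorted : sorted (relpre f <=%O) s.
  by apply: sort_sorted => x y /=; exact: le_total.
exists (fun v => index v s %/ w)%N; split=> [u v uV vV uv|i|v vV].
- have : (index u s < index v s)%N.
    by rewrite ltnNge; apply: contraL uv => vu; rewrite -leqNgt leq_div2r.
  have tr : transitive (relpre f <=%O) by move=> ? ? ? /=; exact: le_trans.
  by apply: (sorted_ltn_index tr s_sorted); rewrite sV.
- pose r v : 'I_w := Ordinal (ltn_pmod (index v s) w0).
  rewrite -[X in (_ <= X)%N]card_ord -(@card_in_imset _ _ r) ?max_card //.
  move=> u v; rewrite !inE => /andP[uV /eqP ui] /andP[vV /eqP vi] [uv].
  have us : u \in s by rewrite sV.
  rewrite -(nth_index u us) [index u s](divn_eq _ w) ui -vi uv -divn_eq.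
  by rewrite nth_index // sV.
by rewrite (leq_ltn_trans (leq_trunc_div _ _)) // -s_size index_mem sV.
Qed.

Lemma separating_value (V : {set U}) (g : U -> nat) i :
  (forall u v, u \in V -> v \in V -> (g u < g v)%N -> f u <= f v) ->
  exists c, forall v, v \in V -> if (g v <= i)%N then f v <= c else c <= f v.
Proof.
move=> gf; pose L := [set v in V | g v <= i]%N; pose H := [set v in V | i < g v]%N.
have [L0|/set0Pn[v0 v0L]] := eqVneq L set0; last first.
  exists (f [arg max_(v > v0 in L) f v]%O).
  case: arg_maxP => // u; rewrite inE => /andP[uV ui] umax v vV.
  by case: leqP => iv; [apply: umax; rewrite inE vV | apply: gf => //; exact: leq_ltn_trans iv].
have vi v : v \in V -> (g v <= i)%N = false.
  by move=> vV; have /setP/(_ v) := L0; rewrite !inE vV.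
have [H0|/set0Pn[v0 v0H]] := eqVneq H set0.
  by exists 0 => v vV; have /setP/(_ v) := H0; rewrite !inE vV ltnNge vi.
exists (f [arg min_(v < v0 in H) f v]%O).
case: arg_minP => // u _ umin v vV; rewrite vi //.
by apply: umin; rewrite inE vV ltnNge vi.
Qed.

End OrderedPartition.

Section BalancedNodes.

(* The cut [c] splits [u] so that [T] is almost contained in [u] (up to a
   fraction 1/Psi(G)) while both sides contain a fraction 1/G of [T]. *)
Definition balanced (U : finType) (f : U -> R) (Psi : nat -> nat) (T : {set U})
    (nd : {set U} * R * nat) :=
  (Psi nd.2 * #|T :\: nd.1.1| <= #|T|)%N /\
  exists A B : {set U}, [/\ A \subset T :&: nd.1.1, B \subset T :&: nd.1.1,
    [disjoint A & B], (#|T| <= nd.2 * #|A|)%N & (#|T| <= nd.2 * #|B|)%N] /\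
    [/\ forall v, v \in A -> f v <= nd.1.2 & forall v, v \in B -> nd.1.2 <= f v].

(* [b]-ary tree of depth [D].  The threshold for descending into a child is
   chosen after those of the deeper levels, so that the loss [Psi G] accumulated
   on the way to a node is far smaller than the balance [G] obtained there. *)
Lemma balanced_nodes (Psi : nat -> nat) D : exists (Gs : seq nat) (h : nat), (0 < h)%N /\
  forall (U : finType) (f : U -> R) b (V : {set U}), (0 < b)%N ->
  exists nodes : seq ({set U} * R * nat),
  [/\ forall nd, nd \in nodes -> nd.1.1 \subset V /\ nd.2 \in Gs,
      forall v : U, (count (fun nd : {set U} * R * nat => v \in nd.1.1) nodes <= D * b)%N &
      forall T : {set U}, (2 * #|V| + 2 * D * b ^ D < #|T| * b ^ D)%N ->
        (h * #|T :\: V| <= #|T|)%N ->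
        exists2 nd, nd \in nodes & balanced f Psi T nd].
Proof.
elim: D => [|D [Gs [h [h0 IH]]]].
  exists [::], 2%N; split=> // U f b V b0; exists [::]; split=> // T VT TV.
  have := subset_leq_card (subsetIr T V); have := cardsID V T.
  by move: VT TV; rewrite expn0; lia.
pose G := (4 * h)%N; exists (G :: Gs), (Psi G + G)%N; split; first by rewrite /G; lia.
move=> U f b V b0; pose w := (#|V| %/ b).+1.
have [g [gf gw gV]] := @ordered_partition U f V w isT.
have gb v : v \in V -> (g v < b)%N.
  move=> /gV; rewrite /w => vV; rewrite ltnNge; apply: contraL vV => bv.
  by rewrite -leqNgt (leq_trans (ltnW (ltn_ceil #|V| b0))) // mulnC leq_mul2r bv orbT.
pose Vi (i : 'I_b) := [set v in V | g v == i].
have /fin_all_exists [c cP] := fun i : 'I_b => separating_value i gf.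
have /fin_all_exists [nodes nodesP] := fun i : 'I_b => IH U f b (Vi i) b0.
exists (map (fun i => (V, c i, G)) (enum 'I_b) ++ flatten (map nodes (enum 'I_b))).
split.
- move=> nd; rewrite mem_cat => /orP[/mapP[i _ ->]|/flatten_mapP[i _ ind]].
    by rewrite /= inE eqxx.
  have [/(_ _ ind)[ndV ndG] _ _] := nodesP i; rewrite inE ndG orbT; split=> //.
  by apply: subset_trans ndV _; apply/subsetP => v; rewrite inE => /andP[].
- move=> v; rewrite count_cat mulSn leq_add //.
    by rewrite (leq_trans (count_size _ _)) // size_map -cardE card_ord.
  have out i : v \notin Vi i -> count (fun nd : {set U} * R * nat => v \in nd.1.1) (nodes i) = 0%N.
    move=> vi; apply/eqP; rewrite -leqn0 leqNgt -has_count; apply: contra vi.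
    by case/hasP => nd /[dup] ind _ vnd; have [/(_ _ ind)[/subsetP/(_ _ vnd)]] := nodesP i.
  rewrite count_flatten sumnE 2!big_map big_enum /=.
  have [/existsP[i0 vi0]|/existsPn none] := boolP [exists i, v \in Vi i].
    rewrite (bigD1 i0) //= big1 ?addn0 => [|i ii0]; first by have [_ ->] := nodesP i0.
    apply: out; apply: contra ii0; move: vi0; rewrite !inE => /andP[_ /eqP e0] /andP[_ /eqP e].
    by apply/eqP/val_inj; rewrite /= -e -e0.
  by rewrite big1 // => i _; apply: out.
move=> T VT TV.
(* Either one child contains T up to a fraction 1/h, and the search descends; or each child misses
   more than |T|/h = 4 |T|/G. In the latter case the first cut with |T|/G below it still leaves
   |T|/G above it, since less than that lies below its block and at most that outside V. *)
have [[i iT]|/forallNP spread] := pselect (exists i : 'I_b, (h * #|T :\: Vi i| <= #|T|)%N).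
  have [_ _ /(_ T)] := nodesP i; case=> // [|nd ind ndT].
    (* A child has at most |V|/b + 1 elements; the term 2 D b^D absorbs this rounding at all
       levels. *)
    rewrite -(ltn_pmul2l b0); apply: leq_ltn_trans (_ : (2 * #|V| + 2 * D.+1 * b ^ D.+1 < _)%N); last first.
      by apply: leq_trans VT _; rewrite expnS; nia.
    have : (b * #|Vi i| <= #|V| + b)%N.
      have := gw i; rewrite -/(Vi i) /w => Vw; have := leq_trunc_div #|V| b; nia.
    have : (b <= b ^ D.+1)%N by rewrite expnS leq_pmulr // expn_gt0 b0.
    rewrite expnS; move: (b ^ D)%N #|Vi i| #|V| => e x y; nia.
  exists nd => //; rewrite mem_cat; apply/orP; right.
  by apply/flatten_mapP; exists i; rewrite ?mem_enum.
pose L i := [set v in T :&: V | g v < i]%N.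
have L_all : L b = T :&: V.
  by apply/setP => v; rewrite !inE; case: (boolP (v \in V)) => [/gb->|]; rewrite ?andbT ?andbF.
have sTV := cardsID V T.
have exL : exists i, (#|T| <= G * #|L i.+1|)%N.
  exists b.-1; rewrite prednK // L_all; move: TV sTV; rewrite /G.
  move: (Psi _) => P; move: #|T :&: V| #|T :\: V| #|T| => x y z; nia.
have [i iL imin] := ex_minnP exL.
have ib : (i < b)%N.
  have : (i <= b.-1)%N.
    apply: imin; rewrite prednK // L_all; move: TV sTV; rewrite /G.
    by move: (Psi _) => P; move: #|T :&: V| #|T :\: V| #|T| => x y z; nia.
  lia.
pose o := Ordinal ib.
have Lsmall : (G * #|L i| <= #|T|)%N.
  case: i {iL ib o} imin => [|i] imin; last first.
    by rewrite leqNgt; apply/negP => /ltnW /imin; rewrite ltnn.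
  suff -> : L 0%N = set0 by rewrite cards0 muln0.
  by apply/setP => v; rewrite !inE andbF.
exists (V, c o, G).
  by rewrite mem_cat; apply/orP; left; apply/mapP; exists o; rewrite ?mem_enum.
split=> /=.
  by apply: leq_trans TV; rewrite leq_mul2r leq_addr orbT.
exists (L i.+1), ((T :&: V) :\: L i.+1).
have cR := cardsID (L i.+1) (T :&: V).
have LTV : L i.+1 \subset T :&: V by apply/subsetP => v; rewrite inE => /andP[].
rewrite (setIidPr LTV) in cR.
split; split=> //.
- exact: subsetDl.
- by rewrite disjoint_sym disjoints_subset setDE subsetIr.
- have LU : (#|L i.+1| <= #|L i| + #|T :&: Vi o|)%N.
    rewrite (leq_trans _ (leq_card_setU _ _)) //; apply/subset_leq_card/subsetP => v.
    by rewrite !inE ltnS leq_eqVlt => /andP[/andP[-> ->]] /orP[->|->]; rewrite ?orbT.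
  have := spread o; have := cardsID (Vi o) T; move: cR LU sTV Lsmall TV; rewrite /G.
  move: (Psi _) => P; move: #|L i| #|L i.+1| #|_ :\: L i.+1| #|T :&: Vi o| #|T :\: Vi o|.
  move: #|T :&: V| #|T :\: V| #|T| => x y t l l' r z z' H1 H2 H3 H4 H5 H6 /negP; rewrite -ltnNge => H7.
  have H5' : (4 * h * y <= t)%N by nia.
  by nia.
- move=> v; rewrite inE => /andP[]; rewrite inE => /andP[_ vV] vi.
  by have := cP o v vV; rewrite /= -ltnS vi.
move=> v; rewrite !inE => /andP[+ /andP[vT vV]]; rewrite vT vV /= => vi.
by have := cP o v vV; rewrite /= -ltnS (negPf vi).
Qed.

End BalancedNodes.

(** * Weak nets *)

Section CoveringPairs.
Variables (I : finType) (T : {set I}) (L : nat).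
Hypotheses (TL : #|T| = L) (L0 : (0 < L)%N).

Lemma card_supersets a (s : {set I}) :
  (#|[set t : {set I} | [&& t \subset T, #|t| == a & s \subset t]]| * L ^ #|s| <= L ^ a)%N.
Proof.
set F := [set t : {set I} | _].
have [F0|/set0Pn[t0 t0F]] := eqVneq F set0; first by rewrite F0 cards0.
have sa : (#|s| <= a)%N.
  by move: t0F; rewrite inE => /and3P[_ /eqP<-]; exact: subset_leq_card.
rewrite -[X in (_ <= L ^ X)%N](subnK sa) expnD leq_mul2r; apply/orP; right.
rewrite -(@card_in_imset _ _ (fun t : {set I} => t :\: s)); last first.
  move=> t t'; rewrite !inE => /and3P[_ _ st] /and3P[_ _ st'] E.
  by rewrite -(setID t s) -(setID t' s) E (setIidPr st) (setIidPr st').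
apply: leq_trans (_ : #|[set u : {set I} | (u \subset T) && (#|u| == a - #|s|)%N]| <= _)%N.
  apply/subset_leq_card/subsetP => _ /imsetP[t + ->].
  rewrite !inE => /and3P[tT /eqP ta st].
  by rewrite (subset_trans (subsetDl _ _) tT) cardsD (setIidPr st) ta /=.
by rewrite cards_draws TL bin_le_expn.
Qed.

Definition covering_pairs a (s : {set I}) := [set P : {set I} * {set I} |
  [&& P.1 \subset T, #|P.1| == a, P.2 \subset T, #|P.2| == a & s \subset P.1 :|: P.2]].

(** A pair covers s through one of the 2^|s| splittings of s into the part inside the first set and
    the rest. The factor L^|s| stays on the left because |s| may exceed a + a. *)
Lemma card_covering_pairs a (s : {set I}) :
  (#|covering_pairs a s| * L ^ #|s| <= 2 ^ #|s| * L ^ (a + a))%N.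
Proof.
pose F (u : {set I}) := [set t : {set I} | [&& t \subset T, #|t| == a & u \subset t]].
have cov : covering_pairs a s \subset \bigcup_(u in powerset s) setX (F u) (F (s :\: u)).
  apply/subsetP => -[t t']; rewrite inE /= => /and5P[tT ta t'T t'a st].
  apply/bigcupP; exists (s :&: t); first by rewrite powersetE subsetIl.
  rewrite !inE /= tT ta t'T t'a subsetIr /=.
  apply/subsetP => i; rewrite !inE => /andP[it is_]; have := subsetP st i is_.
  by move: it; rewrite inE is_ /= => /negPf ->.
apply: (@leq_trans ((\sum_(u in powerset s) #|setX (F u) (F (s :\: u))|) * L ^ #|s|)).
  rewrite leq_mul2r; apply/orP; right; apply: leq_trans (subset_leq_card cov) _.
  by elim/big_rec2: _ => [|u a' A' _ IH]; rewrite ?cards0 // (leq_trans (leq_card_setU _ _)) // leq_add2l.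
rewrite big_distrl /= -card_powerset -sum_nat_const; apply: leq_sum => u.
rewrite powersetE => us; rewrite cardsX expnD -(cardsID u s) (setIidPr us) expnD mulnACA.
by apply: leq_mul; exact: card_supersets.
Qed.

End CoveringPairs.

(** * Tuples crossing a flat, with forbidden subtuples *)

Section Flats.
Variables (I : finType) (X : I -> nat -> R).
Implicit Types (Bad : {set {set I}}).

Definition upd (c : nat -> R) k a j := if j == k then a else c j.

Lemma crosses_upd k c (s : {set I}) : crosses k c X s -> exists a, crosses k.+1 (upd c k a) X s.
Proof.
case=> w ws wc; exists (\sum_i w i * X i k), w => // j; rewrite ltnS leq_eqVlt /upd.
by case: eqVneq => [->|_] //=; exact: wc.
Qed.

Lemma crosses_weaken k c a (s : {set I}) : crosses k.+1 (upd c k a) X s -> crosses k c X s.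
Proof.
case=> w ws wc; exists w => // j jk; rewrite wc ?ltnS ?(ltnW jk) // /upd.
by rewrite ltn_eqF.
Qed.

Lemma crosses_between k c a1 a2 a (s t : {set I}) : a1 <= a <= a2 ->
  crosses k.+1 (upd c k a1) X s -> crosses k.+1 (upd c k a2) X t ->
  crosses k.+1 (upd c k a) X (s :|: t).
Proof.
move=> /andP[a1a aa2] [w ws wc] [v vt vc].
have [l [l01 la]] : exists l, 0 <= l <= 1 /\ l * a1 + (1 - l) * a2 = a.
  have [a12|a12] := eqVneq a1 a2.
    exists 0; rewrite lexx ler01 mul0r add0r subr0 mul1r; split=> //.
    by apply: le_anti; rewrite aa2 -a12 a1a.
  have lt12 : 0 < a2 - a1 by rewrite subr_gt0 lt_neqAle a12 (le_trans a1a).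
  exists ((a2 - a) / (a2 - a1)); split.
    rewrite divr_ge0 ?subr_ge0 //=; last exact: le_trans aa2.
    by rewrite ler_pdivrMr // mul1r; lra.
  by field; rewrite gt_eqF.
exists (fun i => l * w i + (1 - l) * v i); first exact: weights_mix.
move=> j jk; under eq_bigr do rewrite mulrDl -!mulrA.
rewrite big_split /= -!mulr_sumr wc // vc // /upd.
by case: eqP => // _; ring.
Qed.

Definition clean (Bad : {set {set I}}) (s : {set I}) := [forall B in Bad, ~~ (B \subset s)].

Lemma clean_subset Bad (s t : {set I}) : s \subset t -> clean Bad t -> clean Bad s.
Proof.
move=> st /forall_inP H; apply/forall_inP => B /H; apply: contra => Bs.
exact: subset_trans st.
Qed.

Lemma clean_mono Bad (Bad' : {set {set I}}) (s : {set I}) : Bad \subset Bad' -> clean Bad' s -> clean Bad s.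
Proof. by move=> BB /forall_inP H; apply/forall_inP => B /(subsetP BB); exact: H. Qed.

(** Used with m = k + 1 for the tuples that replace points on the current flat, and with m = d for
    the quantity that bounds the size of the net. *)
Definition admissible m k c Bad := [set s : {set I} |
  [&& #|s| == m, `[< crosses k c X s >] & clean Bad s]].

Lemma admissible_sub k c Bad m (s : {set I}) : (k < m)%N -> s \in admissible m k c Bad ->
  exists2 t : {set I}, t \subset s & t \in admissible k.+1 k c Bad.
Proof.
move=> km; rewrite inE => /and3P[/eqP sm /asboolP cs scl].
have [|t [ts tk ct]] := crosses_caratheodory_eq _ cs; first by rewrite sm.
exists t => //; rewrite inE tk eqxx (clean_subset ts scl) andbT.
exact/asboolP.
Qed.

End Flats.

Section NetStep.
Variables (I : finType) (X : I -> nat -> R) (k : nat) (c : nat -> R) (Bad : {set {set I}}).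
Let V := admissible X k.+1 k c Bad.
Variables (f : {set I} -> R).
Hypothesis fP : forall s, s \in V -> crosses k.+1 (upd c k (f s)) X s.

Definition node_bad (nd : {set {set I}} * R * nat) := Bad :|: (V :\: nd.1.1).
Definition node_adm m (nd : {set {set I}} * R * nat) :=
  admissible X m k.+1 (upd c k nd.1.2) (node_bad nd).

(** The charging argument: an m-tuple contains by Carathéodory a (k+1)-tuple t of V, and at each
    node where it is admissible t belongs to the set of the node, as it would be forbidden
    otherwise. There are at most r such nodes. *)
Lemma sum_node_adm m r (nodes : seq ({set {set I}} * R * nat)) : (k < m)%N ->
  (forall s : {set I}, (count (fun nd : {set {set I}} * R * nat => s \in nd.1.1) nodes <= r)%N) ->
  (\sum_(nd <- nodes) #|node_adm m nd| <= r * #|admissible X m k c Bad|)%N.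
Proof.
move=> km hr; pose Om := admissible X m k c Bad.
have sub nd : node_adm m nd \subset Om.
  apply/subsetP => s; rewrite !inE => /and3P[-> /asboolP cs scl].
  rewrite (clean_mono _ scl) ?subsetUl // andbT /=.
  by apply/asboolP; exact: crosses_weaken cs.
have -> : (\sum_(nd <- nodes) #|node_adm m nd| =
           \sum_(s in Om) count (fun nd => s \in node_adm m nd) nodes)%N.
  rewrite (eq_bigr (fun nd => \sum_(s in Om) (s \in node_adm m nd))%N) => [|nd _].
    rewrite exchange_big /=; apply: eq_bigr => s _; rewrite -sum1_count [RHS]big_mkcond.
    by apply: eq_bigr => nd _; case: (_ \in _).
  rewrite -sum1_card [RHS]big_mkcond [LHS]big_mkcond /=; apply: eq_bigr => s _.
  by case: ifP => [/(subsetP (sub nd))->|] //; case: ifP.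
rewrite mulnC -sum_nat_const; apply: leq_sum => s /(admissible_sub km)[t ts tV].
apply: leq_trans (hr t); apply: sub_count => nd /=.
rewrite inE => /and3P[_ _ /forall_inP scl]; apply/negPn/negP => tu.
by have := scl t; rewrite in_setU in_setD tV tu orbT ts => /(_ isT).
Qed.

Variables (T : {set I}) (L : nat).
Hypotheses (TL : #|T| = L) (L0 : (0 < L)%N).
Let VT := [set s in V | s \subset T].
Let inT (F : {set {set I}}) := [set s in F | s \subset T].
Let inTj (F : {set {set I}}) j := [set s in F | (s \subset T) && (#|s| == j)].

Lemma card_VT : (#|VT| <= L ^ k.+1)%N.
Proof.
apply: (@leq_trans #|[set s : {set I} | (s \subset T) && (#|s| == k.+1)]|).
  by apply/subset_leq_card/subsetP => s; rewrite !inE => /andP[/and3P[-> _ _] ->].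
by rewrite cards_draws TL bin_le_expn.
Qed.

Lemma card_node_bad H nd j : (2 * H * #|inTj Bad j| <= L ^ j)%N ->
  (2 * H * #|VT :\: nd.1.1| <= #|VT|)%N -> (H * #|inTj (node_bad nd) j| <= L ^ j)%N.
Proof.
move=> HB HV.
have : (#|inTj (node_bad nd) j| <= #|inTj Bad j| + (j == k.+1) * #|VT :\: nd.1.1|)%N.
  have [jk|jk] := eqVneq j k.+1.
    rewrite mul1n (leq_trans _ (leq_card_setU _ _)) //; apply/subset_leq_card/subsetP => s.
    by rewrite !inE => /andP[/orP[->|/andP[-> ->]] /andP[-> ->]]; rewrite ?orbT.
  rewrite mul0n addn0; apply/subset_leq_card/subsetP => s; rewrite !inE.
  case/andP=> /orP[->//|/andP[_ /andP[/eqP-> _]]] /andP[_ /eqP kj].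
  by rewrite kj eqxx in jk.
have := card_VT; case: eqVneq => [<-|_]; rewrite ?mul1n ?mul0n;
  move: #|VT :\: nd.1.1| #|inTj (node_bad nd) j| #|inTj Bad j| #|VT| (L ^ j)%N HB HV => *; nia.
Qed.

(** A union of two (k+1)-tuples has at most 2 k + 2 elements, so only forbidden sets of size j < 2 k
    + 3 count; those of size j contribute at most a fraction 2^j / H of the pairs, and the powers of
    2 add up. *)
Lemma card_cover_bad H nd : (forall j, H * #|inTj (node_bad nd) j| <= L ^ j)%N ->
  (H * \sum_(B in inT (node_bad nd)) #|covering_pairs T k.+1 B| <=
   2 ^ (2 * k + 3) * L ^ (k.+1 + k.+1))%N.
Proof.
move=> HB; rewrite addn3; set n := (2 * k).+3.
have big (B : {set I}) : (n <= #|B|)%N -> #|covering_pairs T k.+1 B| = 0%N.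
  move=> nB; apply/eqP; rewrite cards_eq0 -subset0; apply/subsetP => P.
  rewrite inE => /and5P[_ /eqP P1 _ /eqP P2 /subset_leq_card BP]; exfalso.
  by have [+ _] := leq_card_setU P.1 P.2; rewrite P1 P2 => le2; move: (leq_trans nB (leq_trans BP le2)); rewrite /n; lia.
have lvl j : (H * \sum_(B in inTj (node_bad nd) j) #|covering_pairs T k.+1 B| <=
              2 ^ j * L ^ (k.+1 + k.+1))%N.
  have Lj : (0 < L ^ j)%N by rewrite expn_gt0 L0.
  rewrite -(leq_pmul2r Lj) -mulnA big_distrl /=.
  apply: (@leq_trans (H * \sum_(B in inTj (node_bad nd) j) 2 ^ j * L ^ (k.+1 + k.+1))).
    rewrite leq_mul2l; apply/orP; right; apply: leq_sum => B; rewrite !inE => /and3P[_ _ /eqP <-].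
    exact: card_covering_pairs.
  by rewrite sum_nat_const mulnA mulnC leq_mul2l HB orbT.
apply: (@leq_trans (\sum_(j < n) H * \sum_(B in inTj (node_bad nd) j) #|covering_pairs T k.+1 B|)).
  rewrite -big_distrr /= leq_mul2l; apply/orP; right.
  rewrite (bigID (fun B : {set I} => #|B| < n)%N) /= addnC big1 ?add0n => [|B /andP[_]]; last first.
    by rewrite -leqNgt => /big.
  pose r (B : {set I}) : 'I_n := inord #|B|.
  rewrite (partition_big r predT) //=; apply: leq_sum => j _.
  rewrite [X in (X <= _)%N]big_mkcond [X in (_ <= X)%N]big_mkcond; apply: leq_sum => B _.
  rewrite !inE; case: ifP => // /andP[/andP[/andP[-> ->] Bn] /eqP <-].
  by rewrite /r inordK // eqxx.
apply: (@leq_trans (\sum_(j < n) 2 ^ j * L ^ (k.+1 + k.+1))); first exact: leq_sum.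
rewrite -big_distrl leq_mul2r /=; apply/orP; right.
elim: n {big} => [|n IH]; first by rewrite big_ord0.
by rewrite big_ord_recr expnS mul2n -addnn; apply: leq_add.
Qed.

(** Each pair of A x B has its two crossing points on opposite sides of the cut, so the union
    crosses the new flat. It contains a forbidden set, which by [card_cover_bad] happens for at most
    half of the required number of pairs, or a clean (k+2)-tuple crossing the new flat. As one
    (k+2)-tuple lies in few unions, there are many such tuples. *)
Lemma node_dense g H (nd : {set {set I}} * R * nat) Psi :
  (L ^ k.+1 <= g * #|VT|)%N -> balanced f Psi VT nd ->
  (2 * (g * nd.2) ^ 2 * 2 ^ (2 * k + 3) <= H)%N ->
  (forall j, H * #|inTj (node_bad nd) j| <= L ^ j)%N ->
  (L ^ k.+2 <= (2 * (g * nd.2) ^ 2 * 2 ^ k.+2) * #|inT (node_adm k.+2 nd)|)%N.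
Proof.
case: nd => [[u a] G] /= gVT [_ [A [B [[AVT BVT AB VA VB] [fA fB]]]]] Hbig HB.
set nd := (u, a, G) in HB *; set W := inT (node_adm k.+2 nd).
have Lk : (L ^ (k.+1 + k.+1) <= (g * G) ^ 2 * (#|A| * #|B|))%N.
  have hA : (L ^ k.+1 <= g * G * #|A|)%N.
    by rewrite (leq_trans gVT) // -mulnA leq_mul2l VA orbT.
  have hB : (L ^ k.+1 <= g * G * #|B|)%N.
    by rewrite (leq_trans gVT) // -mulnA leq_mul2l VB orbT.
  by have := leq_mul hA hB; rewrite -expnD mulnACA.
have cover : setX A B \subset \bigcup_(s in inT (node_bad nd) :|: W) covering_pairs T k.+1 s.
  apply/subsetP => -[t t']; rewrite inE /= => /andP[tA t'B].
  have /andP[tVT _] : (t \in VT) && (t \in u).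
    by have := subsetP AVT t tA; rewrite inE.
  have /andP[t'VT _] : (t' \in VT) && (t' \in u).
    by have := subsetP BVT t' t'B; rewrite inE.
  have [tV tT] : t \in V /\ t \subset T by move: tVT; rewrite inE => /andP.
  have [t'V t'T] : t' \in V /\ t' \subset T by move: t'VT; rewrite inE => /andP.
  have tk : #|t| = k.+1 by move: tV; rewrite inE => /and3P[/eqP].
  have t'k : #|t'| = k.+1 by move: t'V; rewrite inE => /and3P[/eqP].
  suff [s sF st] : exists2 s, s \in inT (node_bad nd) :|: W & s \subset t :|: t'.
    by apply/bigcupP; exists s => //; rewrite inE /= tT tk eqxx t'T t'k eqxx.
  have ttT : t :|: t' \subset T by rewrite subUset tT.
  have [cl|/forall_inPn[s sbad]] := boolP (clean (node_bad nd) (t :|: t')); last first.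
    rewrite negbK => st; exists s => //.
    by rewrite in_setU inE sbad (subset_trans st ttT).
  have aa : f t <= a <= f t' by rewrite fA ?fB.
  have := crosses_between aa (fP tV) (fP t'V).
  move/crosses_caratheodory_eq => [|s [st sk cs]].
    (* A and B are disjoint, hence t and t' differ and their union has at least k + 2 elements. *)
    rewrite -tk ltn_neqAle subset_leq_card ?subsetUl // andbT.
    apply: contraTneq t'B => E; have : t' = t.
      have /eqP tE : t == t :|: t' by rewrite eqEcard subsetUl E leqnn.
      by apply/eqP; rewrite eqEcard tk t'k leqnn andbT tE subsetUr.
    by move=> ->; rewrite (disjointFr AB tA).
  exists s => //; rewrite in_setU; apply/orP; right.
  rewrite inE (subset_trans st ttT) andbT inE sk eqxx (clean_subset st cl) andbT.
  exact/asboolP.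
have U := card_cover_bad HB.
set sU := (\sum_(s in _) _)%N in U.
pose sW := (\sum_(s in W) #|covering_pairs T k.+1 s|)%N.
have AB_le : (#|A| * #|B| <= sU + sW)%N.
  rewrite -cardsX (leq_trans (subset_leq_card cover)) //.
  apply: (@leq_trans (\sum_(s in inT (node_bad nd) :|: W) #|covering_pairs T k.+1 s|)).
    by elim/big_rec2: _ => [|P x y _ IH]; rewrite ?cards0 // (leq_trans (leq_card_setU _ _)) // leq_add2l.
  rewrite /sU /sW [X in (_ <= X + _)%N]big_mkcond [X in (_ <= _ + X)%N]big_mkcond -big_split /=.
  rewrite [X in (X <= _)%N]big_mkcond; apply: leq_sum => s _; rewrite in_setU.
  by case: (s \in inT _); case: (s \in W) => //=; lia.
have hsW : (sW * L ^ k.+2 <= #|W| * (2 ^ k.+2 * L ^ (k.+1 + k.+1)))%N.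
  rewrite /sW big_distrl /= -sum_nat_const; apply: leq_sum => s.
  rewrite inE => /andP[]; rewrite inE => /and3P[/eqP <- _ _] _.
  exact: card_covering_pairs.
have Lp : (0 < L ^ (k.+1 + k.+1))%N by rewrite expn_gt0 L0.
have smallU : (2 * (g * G) ^ 2 * sU <= L ^ (k.+1 + k.+1))%N.
  have p0 : (0 < 2 ^ (2 * k + 3))%N by rewrite expn_gt0.
  rewrite -(leq_pmul2l p0) (leq_trans _ U) // mulnA leq_mul2r; apply/orP; right.
  by rewrite mulnC.
have bigW : (L ^ (k.+1 + k.+1) <= 2 * (g * G) ^ 2 * sW)%N.
  by move: Lk AB_le smallU; move: ((g * G) ^ 2)%N => q; move: (#|A| * #|B|)%N (L ^ _)%N => x y; nia.
rewrite -(leq_pmul2l Lp).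
apply: (@leq_trans (2 * (g * G) ^ 2 * (sW * L ^ k.+2))).
  by rewrite mulnA leq_mul2r bigW orbT.
apply: (@leq_trans (2 * (g * G) ^ 2 * (#|W| * (2 ^ k.+2 * L ^ (k.+1 + k.+1))))).
  by rewrite leq_mul2l hsW orbT.
by move: ((g * G) ^ 2)%N (L ^ _)%N (2 ^ _)%N #|W| => q x y z; nia.
Qed.

End NetStep.

Section Net.
Variables (d D : nat).

(* The last two hypotheses on [T] say that the forbidden subsets are at most a fraction
   1/h of its subsets, and the admissible ones at least a fraction 1/g. *)
Definition net_claim k m (g h C K : nat) :=
  forall (I : finType) (X : I -> Pt d) E b L (c : nat -> R) (Bad : {set {set I}}),
  #|I| = (E * L)%N -> (K * E ^ d <= b ^ D)%N -> (K <= L)%N -> (0 < b)%N ->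
  exists M : list (Pt d),
    (length M * L ^ d <=
     C * b ^ m * #|admissible (fun i => coord (X i)) d k c Bad|)%N /\
    forall (T : {set I}) (W : PSet d), Defs.convex W -> (forall i, i \in T -> W (X i)) ->
    #|T| = L ->
    (forall j, h * #|[set B in Bad | (B \subset T) && (#|B| == j)]| <= L ^ j)%N ->
    (L ^ k.+1 <= g * #|[set s in admissible (fun i => coord (X i)) k.+1 k c Bad | s \subset T]|)%N ->
    exists x, In x M /\ W x.

Lemma level_values (I : finType) (X : I -> nat -> R) m k c (Bad : {set {set I}}) :
  exists f : {set I} -> R, forall s, s \in admissible X m k c Bad ->
    crosses k.+1 (upd c k (f s)) X s.
Proof.
suff /fin_all_exists [f] : forall s, exists a, s \in admissible X m k c Bad ->
    crosses k.+1 (upd c k a) X s by exists f.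
move=> s; have [sA|] := boolP (s \in _); last by exists 0.
by move: sA; rewrite inE => /and3P[_ /asboolP/crosses_upd[a sa] _]; exists a.
Qed.

(** The flat is a line and each d-tuple of V marks a point on it. The net separates consecutive
    blocks of [w] marks; a set containing more than [w] of the tuples has marks in two blocks, hence
    a net point between them. [g.+1] keeps the divisor positive. *)
Lemma net_line g k : d = k.+1 -> net_claim k 0 g 0 (4 * g.+1) (2 * g.+1).
Proof.
move=> dk I X E b L c Bad IE KE KL b0.
set XX := fun i => coord (X i).
set V := admissible XX d k c Bad.
have [f fP] := level_values XX d k c Bad; rewrite -/V in fP.
have Ld : (2 * g.+1 <= L ^ d)%N.
  rewrite (leq_trans KL) // dk -[X in (X <= _)%N]expn1 leq_pexp2l //.
  by rewrite (leq_trans _ KL).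
pose w := (L ^ d %/ (2 * g.+1))%N.
have w0 : (0 < w)%N by rewrite divn_gt0.
have [p [pf pw pV]] := @ordered_partition _ f V w w0.
have /choice [a aP] := fun i => separating_value i pf.
exists (map (fun i => mkpt (upd c k (a i))) (iota 0 (#|V| %/ w))); split.
  rewrite length_size size_map size_iota expn0 muln1.
  have wL : (L ^ d <= 4 * g.+1 * w)%N.
    have := ltn_ceil (L ^ d) (isT : (0 < 2 * g.+1)%N); rewrite -/w; nia.
  apply: (@leq_trans (#|V| %/ w * (4 * g.+1 * w))); first by rewrite leq_mul2l wL orbT.
  by rewrite mulnCA leq_mul2l leq_trunc_div orbT.
move=> T W Wc XW TL _; rewrite -dk -/XX -/V; set VT := [set s in V | _] => LVT.
have wVT : (w < #|VT|)%N.
  have : (w * (2 * g.+1) <= L ^ d)%N by exact: leq_trunc_div.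
  have h : (L ^ d <= g.+1 * #|VT|)%N by rewrite (leq_trans LVT) // leq_mul2r leqnSn orbT.
  move=> /leq_trans /(_ h); rewrite mulnC -mulnA mulnCA leq_pmul2l //; lia.
have [s [t [sVT tVT st]]] : exists s t, [/\ s \in VT, t \in VT & (p s < p t)%N].
  apply: contrapT => H; have /card_gt0P[s0 s0VT] : (0 < #|VT|)%N by apply: leq_ltn_trans wVT.
  move: wVT; apply/negP; rewrite -leqNgt; apply: leq_trans (pw (p s0)).
  apply/subset_leq_card/subsetP => s sVT; rewrite inE; apply/andP; split.
    by move: sVT; rewrite inE => /andP[].
  by case: ltngtP => // lt; exfalso; apply: H; [exists s, s0 | exists s0, s].
have [sV sT] : s \in V /\ s \subset T by move: sVT; rewrite inE => /andP.
have [tV tT] : t \in V /\ t \subset T by move: tVT; rewrite inE => /andP.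
exists (mkpt (upd c k (a (p s)))); split.
  apply: (In_map (fun i => mkpt (upd c k (a i)))); rewrite mem_iota add0n /=.
  by rewrite leq_divRL // (leq_trans _ (ltnW (pV t tV))) // leq_mul2r st orbT.
have sa : f s <= a (p s) <= f t.
  have := aP (p s) s sV; have := aP (p s) t tV.
  by rewrite leqnn leqNgt st /= => -> ->.
apply: (crosses_convex (x := X) (s := s :|: t)) => //.
  by move=> i; rewrite inE => /orP[/(subsetP sT)|/(subsetP tT)]; exact: XW.
by rewrite [X in crosses X _ _ _]dk; apply: crosses_between sa (fP _ sV) (fP _ tV).
Qed.

(** Constants are chosen from the last level upwards. For every possible balance G the next level
    prescribes how few forbidden sets it tolerates, and this is the [Psi] given to [balanced_nodes].
    Only the finitely many G of [Gs] then occur, and sums over [Gs] serve as maxima. *)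
Lemma net_level m k g : (k + m).+1 = d -> exists h C K, net_claim k m g h C K.
Proof.
elim: m k g => [|m IH] k g kd.
  exists 0%N, (4 * g.+1)%N, (2 * g.+1)%N; apply: net_line.
  by rewrite -kd addn0.
have /choice [hf hP] : forall g', exists h, exists C K, net_claim k.+1 m g' h C K.
  by move=> g'; apply: IH; rewrite -kd addSn addnS.
have /choice [Cf CP] := hP; have {CP} /choice [Kf netP] := CP.
pose gam G := (2 * (g * G) ^ 2 * 2 ^ k.+2)%N.
pose H G := (hf (gam G) + 2 * (g * G) ^ 2 * 2 ^ (2 * k + 3))%N.
have [Gs [h0 [h00 tree]]] := balanced_nodes (fun G => 2 * H G)%N D.
pose h := (\sum_(G <- Gs) 2 * H G)%N.
pose C := (D * \sum_(G <- Gs) Cf (gam G))%N.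
(* The terms in g and D make b^D and L large enough for the size condition on T in
   [balanced_nodes]. *)
pose K := (\sum_(G <- Gs) Kf (gam G) + 4 * g + 4 * D * g + 1)%N.
have le_Gs (F : nat -> nat) G : G \in Gs -> (F G <= \sum_(G <- Gs) F G)%N.
  by move=> GGs; rewrite (big_rem G) //= leq_addr.
exists h, C, K => I X E b L c Bad IE KE KL b0.
set XX := fun i => coord (X i).
set V := admissible XX k.+1 k c Bad; set Om := admissible XX d k c Bad.
have [f fP] := level_values XX k.+1 k c Bad; rewrite -/V in fP.
have [nodes [nodesV nodesc nodesP]] := tree _ f b V b0.
have KG G : G \in Gs -> (Kf (gam G) <= K)%N.
  by move=> /(le_Gs (fun G => Kf (gam G))); rewrite /K -!addnA => /leq_trans; apply; exact: leq_addr.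
have /choice [M MP] : forall nd : {set {set I}} * R * nat, exists M : list (Pt d), nd \in nodes ->
    (length M * L ^ d <= Cf (gam nd.2) * b ^ m * #|node_adm XX k c Bad d nd|)%N /\
    forall (T : {set I}) (W : PSet d), Defs.convex W -> (forall i, i \in T -> W (X i)) ->
    #|T| = L ->
    (forall j, hf (gam nd.2) * #|[set B in node_bad XX k c Bad nd | (B \subset T) && (#|B| == j)]| <= L ^ j)%N ->
    (L ^ k.+2 <= gam nd.2 * #|[set s in node_adm XX k c Bad k.+2 nd | s \subset T]|)%N ->
    exists x, In x M /\ W x.
  move=> nd; have [ndn|ndn] := boolP (nd \in nodes); last by exists nil.
  have [_ ndG] := nodesV _ ndn.
  have [||M HM] := netP (gam nd.2) I X E b L (upd c k nd.1.2) (node_bad XX k c Bad nd) IE _ _ b0.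
  - by rewrite (leq_trans _ KE) // leq_mul2r KG ?orbT.
  - exact: leq_trans (KG _ ndG) KL.
  by exists M => _.
exists (flatten (map M nodes)); split.
  have -> : length (flatten (map M nodes)) = (\sum_(nd <- nodes) length (M nd))%N.
    by rewrite length_size size_flatten /shape sumnE !big_map; apply: eq_bigr => nd _; rewrite length_size.
  rewrite big_distrl /=.
  pose CC := (\sum_(G <- Gs) Cf (gam G))%N.
  apply: (@leq_trans (\sum_(nd <- nodes) CC * b ^ m * #|node_adm XX k c Bad d nd|)).
    rewrite !big_seq; apply: leq_sum => nd ndn; have [le _] := MP nd ndn.
    apply: leq_trans le _; rewrite leq_mul2r leq_mul2r (le_Gs (fun G => Cf (gam G))) ?orbT //.
    by have [] := nodesV _ ndn.
  rewrite -big_distrr /=.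
  have kd' : (k < d)%N by rewrite -kd; lia.
  have := sum_node_adm XX c Bad kd' nodesc; rewrite -/Om => le.
  apply: (@leq_trans (CC * b ^ m * (D * b * #|Om|))); first by rewrite leq_mul2l le orbT.
  by rewrite /C -/CC expnS; apply: eq_leq; ring.
move=> T W Wc XW TL hBad gV; rewrite -/XX -/V in gV.
set VT := [set s in V | s \subset T] in gV.
have L0 : (0 < L)%N by rewrite (leq_trans _ KL) // /K addn1.
have E0 : (0 < E)%N.
  by rewrite lt0n; apply/eqP => E0; have := max_card (mem T); rewrite IE E0 TL; lia.
have [nd ndn ndP] : exists2 nd, nd \in nodes & balanced f (fun G => 2 * H G)%N VT nd.
  apply: nodesP; last first.
    suff -> : VT :\: V = set0 by rewrite cards0 muln0.
    by apply/eqP; rewrite setD_eq0; apply/subsetP => s; rewrite inE => /andP[].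
  have Vle : (#|V| <= E ^ d * L ^ k.+1)%N.
    apply: (@leq_trans #|[set s : {set I} | #|s| == k.+1]|).
      by apply/subset_leq_card/subsetP => s; rewrite !inE => /andP[].
    rewrite card_draws (leq_trans (bin_le_expn _ _)) // IE expnMn leq_mul2r.
    by apply/orP; right; rewrite leq_pexp2l // -kd ltnS leq_addr.
  have LL : (L <= L ^ k.+1)%N by rewrite expnS leq_pmulr // expn_gt0 L0.
  have g0 : (0 < g)%N.
    by rewrite lt0n; apply: contraTneq gV => ->; rewrite mul0n -ltnNge expn_gt0 L0.
  have b0D : (0 < b ^ D)%N by rewrite expn_gt0 b0.
  have K1 : ((4 * g + 1) * E ^ d <= b ^ D)%N by rewrite (leq_trans _ KE) // leq_mul2r /K; apply/orP; right; lia.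
  have K2 : (4 * D * g <= L ^ k.+1)%N by rewrite (leq_trans _ LL) // (leq_trans _ KL) // /K; lia.
  have Ed0 : (0 < E ^ d)%N by rewrite expn_gt0 E0.
  have Lk0 : (0 < L ^ k.+1)%N by rewrite expn_gt0 L0.
  move: Vle g0 b0D K1 K2 gV Ed0 Lk0; move: #|V| (L ^ k.+1)%N (b ^ D)%N (E ^ d)%N #|VT| => v l bb e vt.
  move=> Vle g0 b0D K1 K2 gV Ed0 Lk0.
  rewrite -(ltn_pmul2l g0) -(ltn_pmul2l (isT : (0 < 2)%N)).
  apply: (@leq_trans (2 * (l * bb))); last first.
    by rewrite leq_mul2l /= mulnA leq_mul2r gV orbT.
  have h1 : (4 * g * v <= 4 * g * (e * l))%N by rewrite leq_mul2l Vle orbT.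
  have h2 : ((4 * g + 1) * e * l <= bb * l)%N by rewrite leq_mul2r K1 orbT.
  have h3 : (4 * D * g * bb <= l * bb)%N by rewrite leq_mul2r K2 orbT.
  have h4 : (0 < e * l)%N by rewrite muln_gt0 Ed0.
  by nia.
have [_ ndG] := nodesV _ ndn.
have HH j : (H nd.2 * #|[set B in node_bad XX k c Bad nd | (B \subset T) && (#|B| == j)]| <= L ^ j)%N.
  apply: (card_node_bad TL) => //; last by case: ndP.
  rewrite (leq_trans _ (hBad j)) // leq_mul2r; apply/orP; right.
  exact: (le_Gs (fun G => 2 * H G)%N).
have [_ /(_ T W Wc XW TL) []] := MP nd ndn.
- by move=> j; rewrite (leq_trans _ (HH j)) // leq_mul2r leq_addr orbT.
- apply: (node_dense fP TL L0 gV ndP _ HH).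
  by rewrite leq_addl.
move=> x [xM Wx]; exists x; split=> //.
elim: nodes ndn {nodesV nodesc nodesP MP} => //= nd' s IHs; rewrite inE => /orP[/eqP <-|/IHs ih];
  apply/in_app_iff; [by left|by right].
Qed.

End Net.

(** The level k = 0, where the flat is the whole space, the tuples are single points and nothing is
    forbidden; the d-subsets of E L points, divided by L^d, give E^d. Here b is of order E^(d/D), so
    the size is E^(d+o(1)) for large D. Indexing the points allows repetitions. *)
Lemma weak_net d D : (0 < d)%N -> exists C K, forall E b L (X : 'I_(E * L) -> Pt d),
  (K * E ^ d <= b ^ D)%N -> (K <= L)%N -> (0 < b)%N ->
  exists2 M : list (Pt d), (length M <= C * b ^ d.-1 * E ^ d)%N &
    forall W : PSet d, Defs.convex W -> (L <= #|[set i | `[< W (X i) >]]|)%N ->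
    exists x, In x M /\ W x.
Proof.
move=> d0; have [|h [C [K net]]] := @net_level d D d.-1 0 1; first by rewrite add0n prednK.
exists C, K.+1 => E b L X KE KL b0.
have L0 : (0 < L)%N by exact: leq_trans KL.
have [|M [Ml MP]] := net _ X E b L (fun=> 0) set0 (card_ord _) _ (ltnW KL) b0.
  by rewrite (leq_trans _ KE) // leq_mul2r leqnSn orbT.
exists M.
  have Ld : (0 < L ^ d)%N by rewrite expn_gt0 L0.
  rewrite -(leq_pmul2r Ld) (leq_trans Ml) // -!mulnA leq_mul2l; apply/orP; right.
  rewrite leq_mul2l -expnMn; apply/orP; right.
  apply: (@leq_trans #|[set s : {set 'I_(E * L)} | #|s| == d]|).
    by apply/subset_leq_card/subsetP => s; rewrite !inE => /andP[].
  by rewrite card_draws card_ord bin_le_expn.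
move=> W Wc LW; have [|T [_ TW TL]] := @subset_extend _ set0 [set i | `[< W (X i) >]] L (sub0set _).
  by rewrite cards0 LW.
apply: (MP T W Wc _ TL).
- by move=> i /(subsetP TW); rewrite inE => /asboolP.
- by move=> j; rewrite (_ : [set _ in _ | _] = set0) ?cards0 ?muln0 //; apply/setP => B; rewrite !inE.
rewrite mul1n expn1; apply: (@leq_trans #|T|); first by rewrite TL.
rewrite -[X in (X <= _)%N](card_imset _ set1_inj); apply/subset_leq_card/subsetP => _ /imsetP[i iT ->].
rewrite !inE cards1 eqxx sub1set iT andbT /=; apply/andP; split; last first.
  by apply/forall_inP => B; rewrite inE.
apply/asboolP; exists (fun j => (j == i)%:R) => [|j]; last by rewrite ltn0.
split=> [j|j|].
- by rewrite ler0n.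
- by rewrite inE => /negPf->.
by rewrite (bigD1 i) //= eqxx big1 ?addr0 // => j /negPf->.
Qed.

(** * Transversals of polynomial size *)

Lemma polynomial_transversal d D : (0 < d)%N -> (0 < D)%N -> exists Q C : nat, (0 < Q)%N /\
  forall p b, (0 < p)%N -> (0 < b)%N -> (p <= b ^ D)%N ->
  forall (J : finType) (S : J -> PSet d) (A : {set J}),
  (forall j, Defs.convex (S j)) -> (forall j, Defs.compact (S j)) -> (forall j, exists x, S j x) ->
  (forall G : {set J}, G \subset A -> #|G| = p ->
     exists I : {set J}, [/\ I \subset G, inter S I & (Q <= #|I|)%N]) ->
  exists2 T, (length T <= C * b ^ (2 * d * d + d) * p ^ d)%N & pierces S T A.
Proof.
move=> d0 D0; have [C [K net]] := weak_net D d0.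
(* With Q - d = d D, the excess p^d in p^Q is at most b^(d D), so one extra factor b in [B]
   compensates for it. *)
pose Q := (d + d * D)%N; pose c := (4 * Q ^ Q)%N.
have dD0 : (0 < d * D)%N by rewrite muln_gt0 d0.
have dQ : (d < Q)%N by rewrite /Q -addn1 leq_add2l.
have Q0 : (0 < Q)%N by exact: leq_ltn_trans dQ.
have c0 : (0 < c)%N by rewrite muln_gt0 expn_gt0 Q0.
exists Q, (C * (K.+1 * c ^ d) ^ d * c ^ d)%N; split=> // p b p0 b0 pb J S A Sconvex Scompact S0 pqA.
pose B := (Q ^ Q * b * p)%N.
have pd : (p ^ d <= b ^ (d * D))%N by rewrite mulnC expnM leq_expn2r.
have B0 : (0 < B)%N by rewrite !muln_gt0 expn_gt0 Q0 b0.
have BQ : ((p * Q) ^ Q <= B ^ (Q - d))%N.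
  rewrite {3}/Q addKn /B !expnMn mulnC {3}/Q expnD mulnA.
  rewrite leq_mul // leq_mul // -[X in (X <= _)%N]expn1 leq_pexp2l // expn_gt0 Q0 //.
have heavy := heavy_point Sconvex Scompact S0 d0 dQ pqA BQ.
have [L0 hL] := fractional_transversal B0 heavy.
pose L := maxn L0 K; have [xs [xsN xsP]] := hL L (leq_maxl _ _).
(* [fractional_transversal] gives each member a fraction 1/(4 B) of the points. The net needs K E^d
   <= b'^D, where E^d <= c^d b^(d + d D); hence b^(2 d) in [b']. The powers of b in b'^d E^d make 2
   d^2 + d. *)
pose E := (4 * B)%N; pose b' := (K.+1 * c ^ d * b ^ (2 * d))%N.
have EE : E = (c * b * p)%N by rewrite /E /B /c !mulnA.
clearbody c.
pose X (i : 'I_(E * L)) := nth (mkpt (fun=> 0)) xs i.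
have [|||M Ml MP] := net E b' L X.
- rewrite EE !expnMn.
  apply: (@leq_trans (K.+1 ^ D * (c ^ d) ^ D * (b ^ (2 * d)) ^ D)%N); last by rewrite /b' ?expnMn.
  rewrite -mulnA -[X in (_ <= X)%N]mulnA; apply: leq_mul.
    by rewrite (leq_trans (leqnSn K)) // -[X in (X <= _)%N]expn1 leq_pexp2l.
  apply: leq_mul.
    by rewrite -[X in (X <= _)%N]expn1 leq_pexp2l // expn_gt0 c0.
  apply: (@leq_trans (b ^ d * b ^ (d * D))); first by rewrite leq_mul2l pd orbT.
  by rewrite -expnD -expnM leq_pexp2l // mul2n -addnn mulnDl leq_add2r leq_pmulr.
- exact: leq_maxr.
- by rewrite !muln_gt0 !expn_gt0 c0 b0.
exists M.
  apply: leq_trans Ml _.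
  apply: (@leq_trans (C * b' ^ d * E ^ d)).
    do 2!apply: leq_mul => //; apply: leq_pexp2l; last exact: leq_pred.
    by rewrite !muln_gt0 !expn_gt0 c0 b0.
  rewrite EE /b' !expnMn -!expnM expnD; apply: eq_leq; ring.
move=> j jA; apply: MP => //.
rewrite (leq_trans (xsP j jA)) // -sum1_count (big_nth (mkpt (fun=> 0))) big_mkord xsN.
by rewrite sum1dep_card.
Qed.

(** * Removing bad subfamilies *)

Section Greedy.
Variables (d : nat) (J : finType) (S : J -> PSet d).
Hypotheses (Sconvex : forall j, Defs.convex (S j)) (Scompact : forall j, Defs.compact (S j)).
Hypotheses (S0 : forall j, exists x, S j x) (d0 : (0 < d)%N).
Variables (p e : nat) (A : {set J}).
Implicit Types (B G I : {set J}).
Hypothesis pq : forall G, G \subset A -> (#|G| <= p)%N ->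
  exists I, [/\ I \subset G, inter S I & (#|G| <= #|I| + e)%N].

(* If no [m+1] members of [B] intersect, then [A :\: B] satisfies the
   (p - |B|, p - e - m)-property, to which the Hadwiger-Debrunner theorem applies. *)
Lemma transversal_remove B m : B \subset A -> (#|B| <= p)%N ->
  (forall I, I \subset B -> inter S I -> (#|I| <= m)%N) ->
  (d * (e + m + 1 - #|B|) + 1 + #|B| <= p)%N ->
  exists2 T, (length T <= e + 2)%N & pierces S T A.
Proof.
move=> BA Bp Bm hd.
pose P I := (I \subset B) && `[< inter S I >].
have P0 : P set0 by rewrite /P sub0set /=; apply/asboolP; exists (mkpt (fun=> 0)) => j; rewrite inE.
case: (@arg_maxnP _ set0 P (fun I => #|I|) P0) => I0 /andP[I0B /asboolP I0i] I0max.
(* The exact maximum [m0] rather than the bound m makes the sizes match: |B| - m0 + 1 points for B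
   and e + m0 + 1 - |B| for the rest add up to e + 2. *)
pose m0 := #|I0|; have m0m : (m0 <= m)%N by exact: Bm.
(* This yields |B| <= m0 + e, so the subtraction in e + m0 + 1 - |B| is not truncated. *)
have [I1 [I1B I1i I1e]] := pq BA Bp.
have I1m : (#|I1| <= m0)%N by apply: I0max; rewrite /P I1B; apply/asboolP.
have [T1 T1l T1B] := pierces_inter S0 I0B I0i.
have [G|T2 T2l T2A] := hadwiger_debrunner Sconvex Scompact S0 d0 (m := e + m0 + 1 - #|B|) (A := A :\: B).
  move=> GA _ Gl; have GB : [disjoint G & B].
    by rewrite disjoints_subset (subset_trans GA) // setDE subsetIr.
  have GBA : G :|: B \subset A by rewrite subUset BA (subset_trans GA) // subsetDl.
  have cGB : #|G :|: B| = (#|G| + #|B|)%N by rewrite cardsU disjoint_setI0 // cards0 subn0.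
  have dm : (d * (e + m0 + 1 - #|B|) <= d * (e + m + 1 - #|B|))%N.
    by rewrite leq_mul2l; apply/orP; right; lia.
  have [|I [IGB Ii Il]] := pq GBA; first by rewrite cGB; lia.
  have IBm : (#|I :&: B| <= m0)%N.
    by apply: I0max; rewrite /P subsetIr; apply/asboolP; exact: inter_subset (subsetIl _ _) Ii.
  exists (I :\: B); split.
  - apply/subsetP => j; rewrite inE => /andP[jB /(subsetP IGB)].
    by rewrite inE (negPf jB) orbF.
  - exact: inter_subset (subsetDl _ _) Ii.
  - by have := cardsID B I; lia.
exists (T1 ++ T2)%list; first by rewrite length_app; rewrite -/m0 in T1l; lia.
rewrite -(setID A B) (setIidPr BA); exact: pierces_cat.
Qed.

Variables (Q P0 : nat) (st : nat -> nat) (phi : nat -> R).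
Hypotheses (Q0 : (0 < Q)%N) (phi0 : forall P, 0 <= phi P) (p0 : (0 < p)%N) (ep : (e <= p)%N).
Hypothesis step : forall P, (P0 < P)%N -> (P <= p)%N -> (0 < st P < P)%N /\ phi (P - st P)%N + 1 <= phi P.
Hypothesis sparse : forall P B, (P0 < P)%N -> (P <= p)%N -> B \subset A ->
  (forall G, G \subset B -> #|G| = st P -> exists I, [/\ I \subset G, inter S I & (Q <= #|I|)%N]) ->
  exists2 T, (length T + (p - e) <= P)%N & pierces S T B.
Hypothesis final : forall P m, (0 < P)%N -> (P <= P0)%N -> m%:R <= Q%:R * phi p ->
  (d * (P + m + 1) + 1 <= P + d * (p - e))%N.

(** Induction on P = p - |B| with invariant m <= Q (phi p - phi P): a round adds to B a subfamily of
    [st P] members without Q intersecting ones, which raises m by Q, and lowers phi by at least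
    1. *)
Lemma transversal_greedy : exists2 T, (length T <= e + 2)%N & pierces S T A.
Proof.
suff main P : forall B m, B \subset A -> (0 < P)%N -> (#|B| + P = p)%N ->
    (forall I, I \subset B -> inter S I -> (#|I| <= m)%N) ->
    m%:R <= Q%:R * (phi p - phi P) ->
    exists2 T, (length T <= e + 2)%N & pierces S T A.
  apply: (main p set0 0%N) => //; first exact: sub0set.
  - by rewrite cards0.
  - by move=> I; rewrite subset0 => /eqP->; rewrite cards0.
  - by rewrite subrr mulr0.
have [n] := ubnP P; elim: n P => // n IH P Pn B m BA Pp BP Bm mphi.
have [PP0|P0P] := leqP P P0.
  apply: (transversal_remove BA _ Bm); first by lia.
  have mp : m%:R <= Q%:R * phi p.
    by apply: le_trans mphi _; rewrite ler_wpM2l // gerBl.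
  have fin := final Pp PP0 mp; have -> : #|B| = (p - P)%N by lia.
  have [le1|le1] := leqP (e + m + 1) (p - P); first by rewrite (eqP le1) muln0; lia.
  have -> : (e + m + 1 - (p - P) = P + m + 1 - (p - e))%N by lia.
  rewrite mulnBr; have : (d * (p - e) <= d * (P + m + 1))%N by rewrite leq_mul2l; apply/orP; right; lia.
  move: fin; set x := (d * (P + m + 1))%N; set y := (d * (p - e))%N; lia.
have Ple : (P <= p)%N by lia.
have [/andP[s0 sP] phis] := step P0P Ple.
have [all_dense|/existsNP[G /not_implyP[GAB /not_implyP[Gs Gbad]]]] := pselect (forall G, G \subset A :\: B ->
    #|G| = st P -> exists I, [/\ I \subset G, inter S I & (Q <= #|I|)%N]).
  (* One point for each member of B and at most P - (p - e) for the others make at most e points in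
     all. *)
  have [T1 T1l T1A] := sparse P0P Ple (subsetDl A B) all_dense.
  have [T2 T2l T2B] := pierces_card S0 B.
  exists (T2 ++ T1)%list; first by rewrite length_app; lia.
  by rewrite -(setID A B) (setIidPr BA); exact: pierces_cat.
have GB : [disjoint G & B].
  by rewrite disjoints_subset (subset_trans GAB) // setDE subsetIr.
have GBA : G :|: B \subset A by rewrite subUset BA (subset_trans GAB) // subsetDl.
have cGB : #|G :|: B| = (#|G| + #|B|)%N by rewrite cardsU disjoint_setI0 // cards0 subn0.
apply: (IH (P - st P)%N _ (G :|: B) (m + Q)%N GBA).
- by lia.
- by rewrite subn_gt0.
- by rewrite cGB Gs; lia.
- move=> I IGB Ii; rewrite -(cardsID B I) leq_add //.
    by apply: Bm; [exact: subsetIr | exact: inter_subset (subsetIl _ _) Ii].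
  rewrite leqNgt; apply/negP => /ltnW QI; apply: Gbad; exists (I :\: B); split=> //.
    apply/subsetP => j; rewrite inE => /andP[jB /(subsetP IGB)].
    by rewrite inE (negPf jB) orbF.
  exact: inter_subset (subsetDl _ _) Ii.
rewrite natrD (le_trans (lerD mphi (lexx _))) // -[X in _ + X]mulr1 -mulrDr.
by rewrite ler_wpM2l //; move: phis; lra.
Qed.

End Greedy.

Lemma Nat_powE m n : Nat.pow m n = (m ^ n)%N.
Proof. by elim: n => //= n ->; rewrite expnS. Qed.

Lemma finite_transversal d eps : (2 <= d)%N -> 0 < eps -> exists p0 : nat,
  forall p q : nat, (p0 <= p)%N ->
  Rle (Rpower (INR p) (Rplus (Rdiv (INR (d - 1)) (INR d)) eps)) (INR q) -> (q <= p)%N ->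
  (0 < p)%N /\ (0 < q)%N /\
  forall (J : finType) (S : J -> PSet d) (A : {set J}),
  (forall j, Defs.convex (S j)) -> (forall j, Defs.compact (S j)) -> (forall j, exists x, S j x) ->
  (forall G : {set J}, G \subset A -> (#|G| <= p)%N ->
    exists I : {set J}, [/\ I \subset G, inter S I & (#|G| <= #|I| + (p - q))%N]) ->
  exists2 T, (length T <= p - q + 2)%N & pierces S T A.
Proof.
move=> d2 /RltP eps0; have d0 : (0 < d)%N by exact: leq_trans d2.
have [D [/ssrnat.ltP D0 params]] := parameters _ _ (elimT ssrnat.leP d2) eps0.
have [Q [C [Q0 poly]]] := polynomial_transversal d0 D0.
have [p0 p0P] := params Q C; exists p0 => p q /ssrnat.leP pp hq /ssrnat.leP qp.
have [/ssrnat.ltP p1 [b [P0 [st [phi [b0 [pb [phi0 [step final]]]]]]]]] := p0P p q pp hq qp.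
move: b0 pb qp => /ssrnat.ltP b0 /ssrnat.leP + /ssrnat.leP qp; rewrite Nat_powE => pb.
split=> //; split.
  rewrite lt0n; apply/eqP => q0; move: hq; rewrite q0.
  by move/RleP; rewrite leNgt; apply/negP/negPn/RltP; exact: exp_pos.
move=> J S A Sconvex Scompact S0 pqA.
apply: (transversal_greedy Sconvex Scompact S0 d0 (P0 := P0) (st := st) (phi := phi) pqA Q0) => //.
- by move=> P; apply/RleP; exact: phi0.
- exact: leq_subr.
- move=> P P0P Pp; have [[/ssrnat.ltP s0 /ssrnat.ltP sP] [/RleP phis _]] :=
    step P (elimT ssrnat.ltP P0P) (elimT ssrnat.leP Pp).
  by rewrite s0.
- move=> P B P0P Pp BA dense.
  have [[/ssrnat.ltP s0 /ssrnat.ltP sP] [_ /ssrnat.leP]] :=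
    step P (elimT ssrnat.ltP P0P) (elimT ssrnat.leP Pp).
  rewrite !Nat_powE subKn // => bound.
  have [|T Tl TB] := poly (st P) b s0 b0 _ J S B Sconvex Scompact S0 dense.
    by rewrite (leq_trans _ pb) // (leq_trans (ltnW sP)).
  exists T => //; apply: leq_trans bound; rewrite leq_add2r; exact: Tl.
move=> P m P1 PP0 mphi; rewrite subKn //; apply/ssrnat.leP.
apply: final; [exact/ssrnat.ltP | exact/ssrnat.leP |].
by rewrite !INRE; apply/RleP.
Qed.

(** * From finite to infinite families *)

Section Compactness.
Variable d : nat.
Implicit Types (F : Defs.family d) (l : list (PSet d)) (T : list (Pt d)).

Definition stabs T l := forall S, In S l -> exists x, In x T /\ S x.

Lemma open_avoid l : (forall S, In S l -> Defs.compact S) ->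
  Defs.open_set (fun y => forall S, In S l -> ~ S y).
Proof.
elim: l => [|S l IH] cl x nx; first by exists 1; split=> [|y _ S []]; apply/RltP.
have [r [r0 rP]] := open_complement_compact (cl S (or_introl erefl)) (nx S (or_introl erefl)).
have [r' [r'0 r'P]] := IH (fun S' S'l => cl S' (or_intror S'l)) x (fun S' S'l => nx S' (or_intror S'l)).
exists (Num.min r r'); split; first by apply/RltP; rewrite lt_min; apply/andP; split; apply/RltP.
move=> y yx S' /= [<-|S'l].
  by apply: rP => i; have /RltP := yx i; rewrite lt_min => /andP[/RltP].
by apply: r'P => // i; have /RltP := yx i; rewrite lt_min => /andP[_ /RltP].
Qed.

(** Induction on s. If some x in S0 leaves a family whose finite subfamilies need only s points, x
    is used. Otherwise each x in S0 has a finite family [L x] avoiding x that s points cannot stab;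
    all points near x avoid it too. Finitely many x cover S0. A set of s + 1 points stabbing S0 and
    their families [L x] has a point in S0, which is useless for one of these families, so the other
    s points would stab it. *)
Lemma transversal_compactness s F : (forall S, F S -> Defs.compact S) ->
  (forall l, Forall F l -> exists T, (length T <= s)%N /\ stabs T l) ->
  exists T, (length T <= s)%N /\ Defs.transversal T F.
Proof.
elim: s F => [|s IH] F cF hF.
  exists nil; split=> // S FS; have [|T [T0 TS]] := hF [:: S]; first exact: Forall_cons.
  have [x [xT _]] := TS S (or_introl erefl).
  by case: T T0 xT {TS}.
have [[S0 FS0]|/forallNP F0] := pselect (exists S, F S); last first.
  by exists nil; split=> // S /F0.
pose Fx x S := F S /\ ~ S x.
have [[x [Sx hx]]|/forallNP bad] := pselect (exists x, S0 x /\
    forall l, Forall (Fx x) l -> exists T, (length T <= s)%N /\ stabs T l).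
  have [|T [Ts TF]] := IH (Fx x) _ hx; first by move=> S [/cF].
  exists (x :: T); split=> // S FS; have [xS|nxS] := pselect (S x).
    by exists x; split; [left|].
  by have [y [yT Sy]] := TF S (conj FS nxS); exists y; split; [right|].
have /choice [L LP] : forall x, exists l, (S0 x -> Forall (Fx x) l /\
    ~ exists T, (length T <= s)%N /\ stabs T l) /\ (~ S0 x -> l = nil).
  move=> x; have [xS|nxS] := pselect (S0 x); last by exists nil.
  have : ~ forall l, Forall (Fx x) l -> exists T, (length T <= s)%N /\ stabs T l.
    by move=> h; apply: (bad x).
  by move=> /existsNP[l /not_implyP[lF lT]]; exists l.
have LF x : Forall F (L x).
  have [xS|nxS] := pselect (S0 x); last by rewrite (LP x).2.
  by have [/Forall_forall lF _] := (LP x).1 xS; apply/Forall_forall => S /lF[].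
pose U x : PSet d := fun y => S0 x /\ forall S, In S (L x) -> ~ S y.
have [x||C hC] := cF S0 FS0 _ U.
- move=> y [xS ny].
  have [|r [r0 rP]] := @open_avoid (L x) _ y ny.
    by move=> S SL; apply: cF; have /Forall_forall := LF x; apply.
  by exists r; split=> // z /rP.
- move=> x xS; exists x; split=> // S SL.
  by have [/Forall_forall lF _] := (LP x).1 xS; have [] := lF S SL.
have [|T [Ts TG]] := hF (S0 :: flat_map L C).
  apply/Forall_forall => S [<-//|/in_flat_map[x [_ SL]]].
  by have /Forall_forall := LF x; apply.
have [y [yT Sy]] := TG S0 (or_introl erefl).
have [x [xC [xS ny]]] := hC y Sy.
have [_] := (LP x).1 xS; case.
have [T1 [T2 TE]] := in_split _ _ yT.
exists (T1 ++ T2)%list; split.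
  by move: Ts; rewrite TE !length_app /=; lia.
move=> S SL; have [|z [zT Sz]] := TG S.
  by right; apply/in_flat_map; exists x.
exists z; split=> //; move: zT; rewrite TE => /in_app_iff [zT|[yz|zT]].
- by apply/in_app_iff; left.
- by case: (ny S SL); rewrite yz.
by apply/in_app_iff; right.
Qed.

End Compactness.

Lemma NoDup_map_enum (J : finType) (X : Type) (f : J -> X) (A : {set J}) : injective f ->
  NoDup (map f (enum A)).
Proof.
move=> fI; elim: (enum A) (enum_uniq A) => [|j s IH] /=; first by move=> _; constructor.
case/andP=> js us; constructor; last exact: IH.
elim: s js {us IH} => [_ []|i s IH]; rewrite inE /= negb_or => /andP[ji js] inj.
by case: inj => [/fI ij|]; [rewrite ij eqxx in ji | exact: IH].
Qed.

Lemma NoDup_extend (X : Type) (F : X -> Prop) (l l0 : list X) n :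
  NoDup l0 -> Forall F l0 -> (n <= length l0)%N -> NoDup l -> (length l <= n)%N ->
  exists l', [/\ NoDup (l' ++ l)%list, Forall F l' & (length l' + length l = n)%N].
Proof.
move=> nl0 Fl0 nle nl ln; have [m] := ubnP (n - length l)%N.
elim: m l nl ln => // m IH l nl ln lm.
have [e|lt] := eqVneq (length l) n; first by exists nil; split.
have [x [xl0 xl]] : exists x, In x l0 /\ ~ In x l.
  apply: contrapT => /forallNP h; have : incl l0 l.
    by move=> x xl0; apply: contrapT => xl; apply: (h x).
  by move=> /(NoDup_incl_length nl0)/ssrnat.leP; lia.
have [|||l' [nl' Fl' el']] := IH (x :: l).
- by constructor.
- by rewrite /=; lia.
- by rewrite /=; lia.
exists (l' ++ [:: x])%list; split.
- by rewrite -app_assoc.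
- by apply/Forall_app; split=> //; constructor => //; have /Forall_forall := Fl0; apply.
- by move: el'; rewrite length_app /=; lia.
Qed.

(** G is padded to p members of F; of the q intersecting ones at most p - |G| are padding. *)
Lemma pq_property_subfamily d p q (F : Defs.family d) (J : finType) (S : J -> PSet d) (G : {set J}) :
  pq_property p q F -> injective S -> (forall j, F (S j)) -> (#|G| <= p)%N ->
  exists I : {set J}, [/\ I \subset G, inter S I & (#|G| + q <= #|I| + p)%N].
Proof.
move=> [[l0 [l0p [nl0 Fl0]]] [_ Fq]] Sinj FS Gp.
have lG : length (map S (enum G)) = #|G| by rewrite length_size size_map cardE.
have FG : Forall F (map S (enum G)).
  by elim: (enum G) => //= j s IH; constructor.
have [||l' [nl' Fl' el']] := @NoDup_extend _ F (map S (enum G)) l0 p nl0 Fl0 _ (NoDup_map_enum _ Sinj).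
- by rewrite l0p.
- by rewrite lG.
have [|||l1 [l1l [nl1 [l1q [x l1x]]]]] := Fq (l' ++ map S (enum G))%list.
- by move: el'; rewrite length_app; lia.
- exact: nl'.
- by apply/Forall_app.
pose I := [set j in G | `[< S j x >]].
exists I; split; first by apply/subsetP => j; rewrite inE => /andP[].
  by exists x => j; rewrite inE => /andP[_ /asboolP].
have : incl l1 (l' ++ map S (enum I))%list.
  move=> K Kl1; apply/in_app_iff; have /in_app_iff [|KG] := l1l K Kl1; first by left.
  have Kx : K x by have /Forall_forall := l1x; apply.
  right; have [j jG Kj] : exists2 j, j \in G & K = S j.
    have {KG} : exists2 j, j \in enum G & K = S j.
      elim: (enum G) KG => //= i s IH [<-|/IH[j js ->]]; first by exists i; rewrite ?mem_head.
      by exists j; rewrite // inE js orbT.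
    by move=> [j]; rewrite mem_enum; exists j.
  rewrite Kj; apply: In_map; rewrite mem_enum inE jG; apply/asboolP; by rewrite -Kj.
move=> /(NoDup_incl_length nl1)/ssrnat.leP; rewrite l1q length_app.
have -> : length (map S (enum I)) = #|I| by rewrite length_size size_map cardE.
by rewrite lG in el'; lia.
Qed.

Lemma HD_upper_bound d p q : (q <= p)%N ->
  (forall (J : finType) (S : J -> PSet d) (A : {set J}),
    (forall j, Defs.convex (S j)) -> (forall j, Defs.compact (S j)) -> (forall j, exists x, S j x) ->
    (forall G : {set J}, G \subset A -> (#|G| <= p)%N ->
      exists I : {set J}, [/\ I \subset G, inter S I & (#|G| <= #|I| + (p - q))%N]) ->
    exists2 T, (length T <= p - q + 2)%N & pierces S T A) ->
  HD_bound d p q (p - q + 2).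
Proof.
move=> qp fin F Fcc Fpq.
have [S /Fcc[]//||T [/ssrnat.leP Ts TF]] := @transversal_compactness d (p - q + 2) F; last by exists T.
(* The (p,q)-property counts distinct sets, so the finite family must be indexed injectively;
   equality of sets is decided classically. *)
move=> l Fl; pose l' := nodup (fun S S' : PSet d => pselect (S = S')) l.
have Fl' : Forall F l'.
  by apply/Forall_forall => S /nodup_In; have /Forall_forall := Fl; apply.
pose S (i : 'I_(length l')) := List.nth i l' (fun=> True).
have FS i : F (S i).
  by have /Forall_forall := Fl'; apply; apply: nth_In; apply/ssrnat.ltP.
have Sinj : injective S.
  move=> i j ij; apply/val_inj.
  have nl' : NoDup l' by exact: NoDup_nodup.
  have /(NoDup_nth _ (fun=> True)) nth_inj := nl'.
  by apply: nth_inj ij; apply/ssrnat.ltP.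
have Scc i := Fcc _ (FS i).
have [||||T Tl TS] := fin _ S setT.
- by move=> i; have [] := Scc i.
- by move=> i; have [] := Scc i.
- by move=> i; case: Fpq => _ [+ _]; apply.
- move=> G _ Gp; have [I [IG Ii Il]] := pq_property_subfamily Fpq Sinj FS Gp.
  by exists I; split=> //; lia.
exists T; split=> // K Kl.
have /(In_nth _ _ (fun=> True)) [i [/ssrnat.ltP il <-]] : In K l' by apply/nodup_In.
exact: (TS (Ordinal il)).
Qed.

Lemma HD_bounds d eps : le 2 d -> Rlt 0 eps -> exists p0 : nat,
  forall p q : nat, le p0 p ->
  Rle (Rpower (INR p) (Rplus (Rdiv (INR (Nat.sub d 1)) (INR d)) eps)) (INR q) -> le q p ->
  HD_bound d p q (Nat.add (Nat.sub p q) 2) /\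
  forall s, HD_bound d p q s -> le (Nat.add (Nat.sub p q) 1) s.
Proof.
move=> /ssrnat.leP d2 /RltP eps0; have [p0 fin] := finite_transversal d2 eps0.
exists p0 => p q /ssrnat.leP pp hq /ssrnat.leP qp; have [p1 [q1 finpq]] := fin p q pp hq qp.
split; first exact: HD_upper_bound qp finpq.
apply: HD_lower_bound; [|exact/ssrnat.ltP|exact/ssrnat.leP].
by apply/ssrnat.ltP; exact: leq_trans d2.
Qed.

End UpperBound.

Theorem theorem1p3 :
  forall d : nat, (2 <= d)%nat ->
  forall eps : R, 0 < eps ->
  exists p0 : nat,
    forall p q : nat, (p0 <= p)%nat ->
      Rpower (INR p) (INR (d - 1) / INR d + eps) <= INR q ->
      (q <= p)%nat ->
      exists s : nat, is_HD d p q s /\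
        (p - q + 1 <= s)%nat /\ (s <= p - q + 2)%nat.
Proof.
intros d d2 eps eps0.
destruct (UpperBound.HD_bounds d2 eps0) as [p0 bounds].
exists p0. intros p q pp hq qp.
destruct (bounds p q pp hq qp) as [upper lower].
(* The value of HD_d(p,q) is the least bound, which exists because p - q + 2 is a bound. *)
destruct (dec_inh_nat_subset_has_unique_least_element (HD_bound d p q)) as [s [[hs least] _]].
- intro n. apply classic.
- now exists (p - q + 2)%nat.
- exists s. split; [split; assumption|]. split; [now apply lower | now apply least].
Qed.
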